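(* Let $q=p^e\ge 7$ be an odd prime power, $K=\mathbb F_q(t)$, $d=q-1$, and let $f_c(x)=cx^d+t\in K[x]$. Assume that $c\in (K^\times)^{d-1}$ and $v_t(c)=0$. Choose $u\in K^\times$ such that $u^{d-1}=c^{-1}$, and set $$F(x)=u^{-1}f_c(ux)=x^d+C,\qquad C=\frac{t}{u}.$$ Let $K_n=\operatorname{Spl}_K(F^{\circ n})=\operatorname{Spl}_K(f_c^{\circ n})$ and $\mathcal G_n=\operatorname{Gal}(K_n/K)$. Then for every $n\ge 1$, $$\mathcal G_n\cong W_n=\underbrace{C_d\wr C_d\wr\cdots\wr C_d}_{n\text{ factors}}.$$
   Context: $v_t$ is the normalized valuation of $K$ at the prime polynomial $t$. $f^{\circ n}$ denotes the $n$-fold iterate and $\operatorname{Spl}_K(g)$ the splitting field of $g$ over $K$. $C_d$ is the cyclic group of order $d$. If a group $H$ acts on a finite set $S$, then $C_d\wr H:=C_d^S\rtimes H$, with $H$ permuting the factors by $(h\cdot a)_s=a_{h^{-1}s}$. The $n$-fold iterated wreath product $W_n$ is defined by $W_1=C_d$ and $W_n=C_d^{S_{n-1}}\rtimes W_{n-1}$ for $n\ge 2$, where $S_{n-1}$ is the set of $d^{n-1}$ vertices at level $n-1$ of the rooted $d$-ary tree, on which $W_{n-1}$ acts naturally. *)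

(* Defs.v *)
From HB Require Import structures.
From mathcomp Require Import all_boot all_order all_fingroup all_algebra.
From mathcomp Require Import all_solvable all_field.

Set Implicit Arguments.
Unset Strict Implicit.
Unset Printing Implicit Defensive.

Import GRing.Theory.

Section Wreath.

Local Open Scope group_scope.

Variables (A H : finGroupType) (S : finType) (to : {action H &-> S}).

(* The action [(h . a)_s = a_(h^-1 . s)] of [H] on [A^S], transcribed for right
   actions: actions and external semidirect products of the library are right
   handed, [(h, a) * (k, b)] being [(h * k, a^k * b)]. *)
Definition wr_fun (a : {dffun forall _ : S, A}) (h : H) :
  {dffun forall _ : S, A} := [ffun s => a (to s h^-1)].

Fact wr_fun1 : wr_fun^~ 1 =1 id.
Proof. by move=> a; apply/ffunP=> s; rewrite ffunE invg1 act1. Qed.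

Fact wr_funM : forall a h k, wr_fun a (h * k) = wr_fun (wr_fun a h) k.
Proof. by move=> a h k; apply/ffunP=> s; rewrite !ffunE invMg actM. Qed.

Canonical wr_action := TotalAction wr_fun1 wr_funM.

Fact wr_is_groupAction : is_groupAction [set: {dffun forall _ : S, A}] wr_action.
Proof.
move=> h _; rewrite inE; apply/andP; split; first by apply/subsetP=> a; rewrite inE.
apply/morphicP=> a b _ _; rewrite !actpermE /=.
by apply/ffunP=> s; rewrite !ffunE.
Qed.

Canonical wr_groupAction := GroupAction wr_is_groupAction.

Definition wreath : finGroupType := sdprod_by wr_groupAction.

(* The action of [wreath] on the vertices one level further down: [(s, x)] is
   the child [x] of the vertex [s].  An element [(h, a)] of [wreath] is the
   product "[h] then [a]", where [h] moves [(s, x)] to [(s . h, x)] and [a]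
   moves [(s, x)] to [(s, x * a s)]. *)
Definition wr_child (sx : S * A) (w : wreath) : S * A :=
  let s' := to sx.1 (val w).1 in (s', sx.2 * (val w).2 s').

Fact wr_child1 : wr_child^~ 1 =1 id.
Proof.
by case=> s x; rewrite /wr_child /= act1 ffunE mulg1.
Qed.

Fact wr_childM sx (v w : wreath) :
  wr_child sx (v * w) = wr_child (wr_child sx v) w.
Proof.
case: sx => s x; rewrite /wr_child /= !actM; congr pair.
by rewrite !ffunE actK mulgA.
Qed.

Definition wr_child_action := TotalAction wr_child1 wr_childM.

End Wreath.

Record permGroup := PermGroup {
  pg_group : finGroupType;
  pg_set : finType;
  pg_act : {action pg_group &-> pg_set}
}.

(* [tree_group d k] is [W_(k+1)] acting on level [k+1] of the rooted [d]-ary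
   tree, the children of a vertex being labelled by [C_d] itself, on which [C_d]
   acts by translation.  [C_d] is the additive group of ['Z_d], which has order
   [d] only when [1 < d]. *)
Fixpoint tree_group (d k : nat) : permGroup :=
  if k is k'.+1 then
    PermGroup (wr_child_action ('Z_d) (pg_act (tree_group d k')))
  else @PermGroup ('Z_d) ('Z_d) 'R%act.

(* Meaningful for [0 < n] only. *)
Definition iter_wreath (d n : nat) : finGroupType := pg_group (tree_group d n.-1).

Local Open Scope ring_scope.

Section RatFun.

Variable k : fieldType.

Definition ratfun_t : {fraction {poly k}} := tofrac 'X.

(* Only meaningful on nonzero elements. *)
Definition vt (x : {fraction {poly k}}) : int :=
  (mup 0 \n_(generic_quotient.repr x))%:Z -
  (mup 0 \d_(generic_quotient.repr x))%:Z.

Fact vt_frac (a b : {poly k}) : a != 0 -> b != 0 ->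
  vt (tofrac a / tofrac b) = (mup 0 a)%:Z - (mup 0 b)%:Z.
Proof.
move=> a0 b0; set x := _ / _; rewrite /vt; set r := generic_quotient.repr x.
have d0 : \d_r != 0 by exact: denom_ratioP.
have xdE : x * tofrac \d_r = tofrac \n_r.
  rewrite -[x]generic_quotient.reprK -/r; unlock FracField.tofrac.
  rewrite -[LHS]FracField.pi_mul; apply/eqmodP.
  rewrite /= FracField.equivfE /FracField.mulf !numden_Ratio ?mulr1 ?oner_eq0 //.
  by rewrite mulrC.
have adE : a * \d_r = \n_r * b.
  apply/eqP; rewrite -tofrac_eq !rmorphM /= -xdE /x mulrAC.
  by rewrite divfK ?tofrac_eq0.
have n0 : \n_r != 0.
  by apply: contra_eq_neq adE => ->; rewrite mul0r mulf_neq0.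
have /(congr1 (mup 0)) := adE; rewrite !mupM // => mE.
by apply/eqP; rewrite subr_eq addrAC eq_sym subr_eq -!PoszD mE.
Qed.

Definition unicritical (d : nat) (c : {fraction {poly k}}) :
  {poly {fraction {poly k}}} := c *: 'X^d + ratfun_t%:P.

End RatFun.

Definition iter_poly (R : nzRingType) (n : nat) (g : {poly R}) : {poly R} :=
  iter n (fun h => g \Po h) 'X.

(* [E] is the splitting field over [K] of [g : {poly K}], inside [L]. *)
Definition is_Spl (K : fieldType) (L : splittingFieldType K) (g : {poly K})
  (E : {subfield L}) : Prop :=
  splittingFieldFor 1 (map_poly (in_alg L) g) E.

(* Main.v *)
(* Write C = g/h with g, h coprime polynomials; t divides g exactly once.  The
   roots of F^(j+1) are the d-th roots of the elements lam - C, for lam a root of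
   F^j, so by Kummer theory it suffices that no product of the lam - C with
   exponents in [0, d), not all zero, is a d-th power in the splitting field of
   F^j.  The product of all the lam - C is, up to sign, the point F^(j+1)(0) of
   the critical orbit.
   The recursion for the critical orbit is an equation A + B = D in coprime
   polynomials, where A and B are almost d-th powers, and the Mason-Stothers
   inequality (d >= 6 is used here) provides, for j > 0, an irreducible P dividing
   F^(j+1)(0) exactly once, prime to h and to all F^(i+1)(0) with i < j; for j = 0
   one takes P = t.  The
   differences of the roots of F^j are then units at P, so the splitting field
   of F^j is unramified over P, and the lam - C are pairwise comaximal at P with
   product P times a unit.  If lam - C occurs with exponent in (0, d) in a d-th
   power, this forces lam - C to be a unit at P; as the Galois group is
   transitive on the lam, their product P would be a unit. *)
From HB Require Import structures.
Require Import Defs.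
From mathcomp Require Import all_boot all_order all_fingroup all_algebra.
From mathcomp Require Import all_solvable all_field zify ring.

Set Implicit Arguments.
Unset Strict Implicit.
Unset Printing Implicit Defensive.

Import GRing.Theory.
Local Open Scope ring_scope.

Local Notation deg p := (size p).-1.

(** * Irreducible factors of polynomials *)

Section Degree.

Variable k : fieldType.
Implicit Types p q a b P : {poly k}.

Lemma deg_mul p q : p != 0 -> q != 0 -> deg (p * q) = (deg p + deg q)%N.
Proof.
move=> p0 q0; rewrite size_mul //; move: p0 q0; rewrite -!size_poly_gt0.
by move: (size p) (size q) => a b; lia.
Qed.

Lemma deg_exp p n : deg (p ^+ n) = (n * deg p)%N.
Proof. by rewrite size_exp mulnC. Qed.

Lemma irreducible_dvdM P p q :
  irreducible_poly P -> (P %| p * q) = (P %| p) || (P %| q).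
Proof.
move=> irr_P; have [P_p | P_p] := boolP (P %| p); first exact: dvdp_mulr.
by rewrite Gauss_dvdpr // irreducible_poly_coprime.
Qed.

Lemma irreducible_dvdX P p n :
  irreducible_poly P -> (P %| p ^+ n) = (0 < n)%N && (P %| p).
Proof.
move=> irr_P; elim: n => [|n IH]; last first.
  by rewrite exprS irreducible_dvdM // IH /= orb_andr orbb andbC; case: (_ %| _).
apply/negP; rewrite dvdp1 => /eqP sP; have := irr_P.1; by rewrite sP.
Qed.

Lemma coprime_cofactors a b : b != 0 ->
  exists a1 b1 g, [/\ a = a1 * g, b = b1 * g, coprimep a1 b1, g != 0 & b1 != 0].
Proof.
move=> b0; have g0 : gcdp a b != 0 by rewrite gcdp_eq0 negb_and b0 orbT.
have [/dvdpP[a1 Da] /dvdpP[b1 Db]] := (dvdp_gcdl a b, dvdp_gcdr a b).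
exists a1, b1, (gcdp a b); split=> //; last first.
  by apply: contraNneq b0 => b10; rewrite Db b10 mul0r.
apply/coprimepP => c c_a1 c_b1; rewrite -size_poly_eq1 -dvdp1 -(dvdp_mul2r _ _ g0).
rewrite mul1r dvdp_gcd; apply/andP.
by split; [rewrite [X in _ %| X]Da | rewrite [X in _ %| X]Db]; rewrite dvdp_mul2r.
Qed.

End Degree.

Section PolyFactor.

Variable k : finFieldType.
Implicit Types (p q D N P Q : {poly k}).

(** Strong induction on the size: over a finite field [irreducibleb] is a finite search, so a
    reducible polynomial yields a smaller nonconstant divisor to descend to. *)
Lemma irreducible_divisor p :
  (1 < size p)%N -> exists2 P, irreducible_poly P & P %| p.
Proof.
have [n] := ubnP (size p); elim: n p => // n IH p /ltnSE le_pn p_gt1.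
have [/irreducibleP irr_p | nirr] := boolP (irreducibleb p).
  by exists p.
have p_neq0 : p != 0 by rewrite -size_poly_gt0 (ltn_trans _ p_gt1).
move: nirr.
rewrite /irreducibleb (_ : (1 < size p)%N) //=.
rewrite negb_forall => /existsP[q].
rewrite negb_imply -Pdiv.Idomain.dvdpE -ltnNge => /andP[q_p q_gt1].
have [|P irr_P P_q] := IH q _ q_gt1.
  apply: leq_ltn_trans (size_npoly q) (leq_trans _ le_pn).
  by rewrite ltn_predL ltnW.
by exists P; rewrite ?(dvdp_trans P_q).
Qed.

Lemma irreducible_multiplicity P p : irreducible_poly P -> p != 0 ->
  exists e U, p = P ^+ e * U /\ ~~ (P %| U).
Proof.
move=> irr_P; have [n] := ubnP (size p); elim: n p => // n IH p /ltnSE le_pn p0.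
have [/dvdpP[q Dp] | P_p] := boolP (P %| p); last by exists 0%N, p; rewrite mul1r.
have q0 : q != 0 by apply: contraNneq p0 => q0; rewrite Dp q0 mul0r.
have [|e [U [Dq P_U]]] := IH q _ q0.
  move: le_pn; rewrite Dp size_mul ?(irredp_neq0 irr_P) //.
  have : (0 < size q)%N by rewrite size_poly_gt0.
  by move: (size q) (size P) irr_P.1 => a b; lia.
by exists e.+1, U; split=> //; rewrite Dp Dq exprSr mulrAC.
Qed.

(** [Q] is the product of the P^(e-1) over the prime powers P^e exactly dividing [D]. If the first
    alternative fails, each P has either e >= 2, so that e deg P <= 2(e-1) deg P, or e = 1 and
    divides [N], which then pays for deg P. The induction strips one prime power at a time. *)
Lemma simple_factor_or_dvd_deriv D N : D != 0 -> N != 0 ->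
  (exists P, [/\ irreducible_poly P, P %| D, ~~ (P %| N) & ~~ (P ^+ 2 %| D)]) \/
  exists Q, [/\ Q %| D, Q %| D^`() & (deg D <= 2 * deg Q + deg N)%N].
Proof.
have [n] := ubnP (size D); elim: n D N => // n IH D N /ltnSE le_Dn D0 N0.
have [D_le1 | D_gt1] := leqP (size D) 1.
  by right; exists 1; rewrite !dvd1p; split=> //; lia.
have [P irr_P P_D] := irreducible_divisor D_gt1.
have [|simple_P] := boolP ((P %| N) || (P ^+ 2 %| D)); last first.
  by left; exists P; move: simple_P; rewrite negb_or => /andP[].
move=> sqP.
have P_neq0 := irredp_neq0 irr_P.
have [e [U [DD P_U]]] := irreducible_multiplicity irr_P D0.
have U0 : U != 0 by apply: contraNneq D0 => U0; rewrite DD U0 mulr0.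
have e_gt0 : (0 < e)%N.
  by rewrite lt0n; apply: contraNneq P_U => e0; rewrite DD e0 mul1r in P_D.
(* [N] loses one factor [P] when it has one, so that no part of its degree is charged twice. *)
have [N1 N1P] : exists N1, N = if P %| N then N1 * P else N1.
  by have [/dvdpP[q Dq] | _] := boolP (P %| N); [exists q | exists N].
have N10 : N1 != 0.
  by apply: contraNneq N0 => N10; rewrite N1P N10 mul0r if_same.
have [|[P' [irr_P' P'_U P'_N1 P'2_U]]|[Q [Q_U Q_dU leU]]] := IH U N1 _ U0 N10.
- apply: leq_trans le_Dn; apply: leq_ltn_trans (leqSpred _) _.
  rewrite -(ltn_predRL) DD deg_mul ?expf_neq0 // deg_exp -[X in (X < _)%N]add0n.
  by rewrite ltn_add2r muln_gt0 e_gt0 ltn_predRL irr_P.1.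
- left; exists P'.
  have coPP' : coprimep P' P.
    rewrite irreducible_poly_coprime //; apply: contraNN P_U => P'_P.
    have := irr_P.2 P' _ P'_P; have := irr_P'.1; rewrite neq_ltn orbC => -> /(_ isT).
    by move=> /eqp_dvdl <-.
  split=> //; first by rewrite DD dvdp_mull.
    by rewrite N1P; case: ifP; rewrite ?Gauss_dvdpl.
  by rewrite DD Gauss_dvdpr ?coprimep_expr ?coprimep_expl.
right.
have Q0 : Q != 0 by apply: contraTneq Q_U => ->; rewrite dvd0p.
exists (P ^+ e.-1 * Q); split.
- by rewrite DD dvdp_mul // dvdp_exp2l ?leq_pred.
- rewrite DD derivM dvdp_add // dvdp_mul ?dvdp_exp2l ?leq_pred //.
  by rewrite deriv_exp -mulrnAl mulrC dvdp_mulr.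
rewrite DD !deg_mul ?expf_neq0 // !deg_exp.
have: (deg N = (if (P %| N)%R then deg P else 0) + deg N1)%N.
  by rewrite {1}N1P; case: ifP => // _; rewrite deg_mul // addnC.
have e1P : e = 1%N -> P %| N.
  move=> e1; move: sqP; rewrite DD e1 expr1 expr2.
  by rewrite dvdp_mul2l // (negbTE P_U) orbF.
move: leU e1P e_gt0; move: (P %| N) (deg N) (deg N1) (deg Q) (deg U) (deg P).
clear=> PN a b c v x leU e1 e_gt0; case: (leqP 2 e) => [e2 | lt_e2].
  have : (e * x <= 2 * (e.-1 * x))%N.
    by rewrite mulnA leq_mul2r; apply/orP; right; lia.
  by move: (e * x)%N (e.-1 * x)%N => y z; case: PN {e1}; lia.
have e_1 : e = 1%N by lia.
by rewrite (e1 e_1) // e_1; lia.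
Qed.

End PolyFactor.

(** * Mason-Stothers and primitive primes of the critical orbit *)

Section Mason.

Variable k : fieldType.
Implicit Types A B D Q W : {poly k}.

Lemma size_wronskian A B : A != 0 -> B != 0 ->
  (size (A * B^`() - A^`() * B)%R <= deg A + deg B)%N.
Proof.
move=> A0 B0; have [dA dB] := (lt_size_deriv A0, lt_size_deriv B0).
have leM (p q : {poly k}) : (size (p * q)%R <= (size p + size q).-1)%N.
  exact: size_polyMleq.
apply: leq_trans (size_polyD _ _) _; rewrite size_polyN geq_max.
apply/andP; split; apply: leq_trans (leM _ _) _.
  by move: dB; have := A0; rewrite -size_poly_gt0; clear;
     move: (size A) (size B) (size B^`()) => a b c; lia.
by move: dA; have := B0; rewrite -size_poly_gt0; clear;
   move: (size A) (size B) (size A^`()) => a b c; lia.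
Qed.

(** The Wronskian of [A] and [B] is also that of [A] and [A + B], and that of [A + B] and [B]. The
    pairwise coprime [QA], [QB], [QD] all divide it, while its degree is less than the sum of the
    two degrees in each of these pairs. *)
Lemma mason_stothers A B QA QB QD :
    coprimep A B -> A^`() != 0 -> B != 0 -> A + B != 0 ->
    QA %| A -> QA %| A^`() -> QB %| B -> QB %| B^`() ->
    QD %| A + B -> QD %| (A + B)^`() ->
  (deg QA + deg QB + deg QD + maxn (deg A) (deg B) <
   deg A + deg B + deg (A + B)%R)%N.
Proof.
move=> coAB dA0 B0 D0 QA_A QA_dA QB_B QB_dB QD_D QD_dD.
have A0 : A != 0 by apply: contraNneq dA0 => ->; rewrite deriv0.
set D := A + B in D0 QD_D QD_dD *; set W := A * B^`() - A^`() * B.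
have W_AD : W = A * D^`() - A^`() * D.
  by rewrite /W /D derivD !mulrDr opprD addrACA [_ * A]mulrC subrr add0r.
have W_DB : W = D * B^`() - D^`() * B.
  by rewrite /W /D derivD !mulrDl opprD addrACA [B * _]mulrC subrr addr0.
have W0 : W != 0.
  (* If the Wronskian vanished, [A], being prime to [B], would divide its own nonzero derivative,
     which has smaller degree. *)
  apply: contraNneq dA0 => /eqP; rewrite subr_eq0 => /eqP WE.
  have : A %| A^`() * B by rewrite -WE dvdp_mulr.
  rewrite Gauss_dvdpl // => A_dA; apply: contraTT (lt_size_deriv A0) => dA_neq0.
  by rewrite -leqNgt dvdp_leq.
have coAD : coprimep A D by rewrite /D -[X in X + _]mul1r coprimep_addl_mul.
have coBD : coprimep B D.
  by rewrite /D addrC -[X in X + _]mul1r coprimep_addl_mul coprimep_sym.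
have : QA * QB * QD %| W.
  have co_QAQB := coprimep_dvdl QB_B (coprimep_dvdr QA_A coAB).
  have co_QD : coprimep (QA * QB) QD.
    rewrite coprimepMl (coprimep_dvdl QD_D (coprimep_dvdr QA_A coAD)).
    by rewrite (coprimep_dvdl QD_D (coprimep_dvdr QB_B coBD)).
  rewrite !Gauss_dvdp //; apply/andP; split; last first.
    by rewrite W_AD; apply: dvdp_sub; [apply: dvdp_mull | apply: dvdp_mull].
  apply/andP; split; rewrite /W; apply: dvdp_sub.
  - exact: dvdp_mulr.
  - exact: dvdp_mulr.
  - exact: dvdp_mull.
  - exact: dvdp_mull.
move/(dvdp_leq W0).
have nz (Q p : {poly k}) : p != 0 -> Q %| p -> Q != 0.
  by move=> p0; apply: contraTneq => ->; rewrite dvd0p.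
have [[QA0 QB0] QD0] := (nz _ _ A0 QA_A, nz _ _ B0 QB_B, nz _ _ D0 QD_D).
have := polySpred QA0; have := polySpred QB0; have := polySpred QD0.
have := size_wronskian A0 B0; rewrite -/W.
have := size_wronskian A0 D0; rewrite -W_AD.
have := size_wronskian D0 B0; rewrite -W_DB.
rewrite !size_mul ?mulf_neq0 //.
have: deg D = maxn (deg A) (deg B) \/ deg A = deg B.
  case: (ltngtP (size A) (size B)) => [lt_AB | lt_BA | ->]; last by right.
    left; rewrite /D addrC size_polyDl //; apply/esym/maxn_idPr; clear -lt_AB.
    by move: (size A) (size B) lt_AB => a b; lia.
  left; rewrite size_polyDl //; apply/esym/maxn_idPl; clear -lt_BA.
  by move: (size A) (size B) lt_BA => a b; lia.
clear; move: (size W) (size QA) (size QB) (size QD) (deg A) (deg B) (deg D).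
by move=> w qa qb qd a b c; lia.
Qed.

End Mason.

(* For C = g/h and F(x) = x^d + C one has F^n(0) = g H_n / h^(d^(n-1)), H_n being
   this cofactor. *)
Fixpoint orbit_cofactor (k : fieldType) (g h : {poly k}) (d n : nat) : {poly k} :=
  if n is n'.+1 then
    g ^+ d.-1 * orbit_cofactor g h d n' ^+ d + h ^+ (d ^ n').-1
  else 0.

Section CriticalOrbit.

Variables (k : fieldType) (g h g1 : {poly k}) (d : nat).
Hypotheses (co_gh : coprimep g h) (gE : g = 'X * g1) (g1_0 : ~~ root g1 0).
Hypothesis d_gt1 : (1 < d)%N.

Local Notation H := (orbit_cofactor g h d).

Let d_gt0 : (0 < d)%N. Proof. exact: ltnW. Qed.
Let dB_gt0 : (0 < d.-1)%N. Proof. by rewrite -ltnS prednK. Qed.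

Lemma orbit_cofactor1 : H 1 = 1.
Proof. by rewrite /= expr0n gtn_eqF // mulr0 add0r. Qed.

(** The recursion F^(n+1)(0) = F^n(0)^d + C, written for the numerators over the common denominator
    h^(d^n). *)
Lemma orbit_cofactorS n :
  g * H n.+1 = (g * H n) ^+ d + g * h ^+ (d ^ n).-1.
Proof. by rewrite /= mulrDr mulrA -exprS prednK // exprMn. Qed.

Let HE n : H n.+1 = g ^+ d.-1 * H n ^+ d + h ^+ (d ^ n).-1. Proof. by []. Qed.

Let pow_gt1 n : (1 < d ^ n.+1)%N.
Proof. by rewrite -(exp1n n.+1) ltn_exp2r. Qed.

Let pow_gt0 n : (0 < d ^ n)%N. Proof. by rewrite expn_gt0 d_gt0. Qed.

Lemma coprime_orbit_cofactor_num n : coprimep g (H n.+1).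
Proof.
rewrite /= -(prednK dB_gt0) exprS -mulrA mulrC coprimep_addl_mul.
exact: coprimep_expr.
Qed.

Lemma coprime_orbit_cofactor_den n : coprimep h (H n.+1).
Proof.
elim: n => [|n IH]; first by rewrite orbit_cofactor1 coprimep1.
(* Since d^(n+1) > 1, the exponent of [h] is positive, so modulo [h] only the product of powers of
   [g] and [H n.+1] remains. *)
rewrite HE; case: (d ^ n.+1)%N (pow_gt1 n) => [|[|m]] // _.
rewrite addrC exprSr coprimep_addl_mul coprimepMr !coprimep_expr //.
by rewrite coprimep_sym.
Qed.

Lemma numer_neq0 : g != 0.
Proof.
rewrite gE mulf_neq0 ?polyX_eq0 //.
by apply: contraNneq g1_0 => ->; rewrite root0.
Qed.

Lemma numer_root0 : root g 0. Proof. by rewrite gE rootM rootX eqxx. Qed.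

Lemma denom_root0 : ~~ root h 0.
Proof. exact: coprimep_root co_gh numer_root0. Qed.

Lemma orbit_cofactor_root0 n : ~~ root (H n.+1) 0.
Proof. exact: coprimep_root (coprime_orbit_cofactor_num n) numer_root0. Qed.

Lemma orbit_cofactor_neq0 n : H n.+1 != 0.
Proof. by apply: contraNneq (orbit_cofactor_root0 n) => ->; rewrite root0. Qed.

Local Notation delta := (maxn (deg g) (deg h)).

Lemma deg_orbit_cofactor n : (deg (H n.+1) <= (d ^ n).-1 * delta)%N.
Proof.
elim: n => [|n IH]; first by rewrite orbit_cofactor1 size_poly1.
have h0 : h != 0 by apply: contraNneq denom_root0 => ->; rewrite root0.
have le_add (p q : {poly k}) : (deg (p + q)%R <= maxn (deg p) (deg q))%N.
  have := size_polyD p q; move: (size p) (size q) (size _) => a b c; lia.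
rewrite HE; apply: leq_trans (le_add _ _) _; rewrite geq_max.
rewrite deg_mul ?expf_neq0 ?numer_neq0 ?orbit_cofactor_neq0 // !deg_exp.
apply/andP; split; last by rewrite leq_mul2l leq_maxr orbT.
have := leq_maxl (deg g) (deg h); rewrite expnS; move: (pow_gt0 n) IH.
move: delta (deg g) (deg _) (d ^ n)%N d_gt0 => D a c x; clear.
by case: (d) => // d' _; case: x => // x _ /=; nia.
Qed.

(** If deg g <= deg h, the power of [h] alone attains the bound. Otherwise the term in [g] dominates
    at every stage, and induction gives the exact degree of the cofactors. *)
Lemma deg_orbit_terms n :
  ((d ^ n.+1).-1 * delta <=
   maxn (deg (g ^+ d.-1 * H n.+1 ^+ d)%R) (deg (h ^+ (d ^ n.+1).-1)%R))%N.
Proof.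
have gH m : deg (g ^+ d.-1 * H m.+1 ^+ d) = (d.-1 * deg g + d * deg (H m.+1))%N.
  by rewrite deg_mul ?expf_neq0 ?numer_neq0 ?orbit_cofactor_neq0 // !deg_exp.
have [le_gh | lt_hg] := leqP (deg g) (deg h).
  by rewrite deg_exp leq_max leqnn orbT.
rewrite leq_max gH; apply/orP; left.
suff -> : deg (H n.+1) = ((d ^ n).-1 * deg g)%N.
  rewrite expnS; move: d_gt0 (pow_gt0 n); move: (d ^ n)%N (deg g) => x a; clear.
  by case: (d) => // d' _; case: x => // x _ /=; nia.
elim: n => [|n IH]; first by rewrite orbit_cofactor1 size_poly1.
have degA : deg (g ^+ d.-1 * H n.+1 ^+ d) = ((d ^ n.+1).-1 * deg g)%N.
  rewrite gH IH expnS; move: d_gt0 (pow_gt0 n).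
  move: (d ^ n)%N (deg g) => x a; clear.
  by case: (d) => // d' _; case: x => // x _ /=; nia.
rewrite HE size_polyDl //.
have lt_deg (p q : {poly k}) : p != 0 -> (deg q < deg p)%N -> (size q < size p)%N.
  by move: (size p) (size q) => a b _; lia.
apply: lt_deg.
  by rewrite mulf_neq0 ?expf_neq0 ?numer_neq0 ?orbit_cofactor_neq0.
by rewrite degA deg_exp ltn_mul2l lt_hg -ltnS prednK ?pow_gt1.
Qed.

End CriticalOrbit.

(** The lowest coefficient survives differentiation. This supplies the nonvanishing derivative that
    Mason-Stothers requires in positive characteristic. *)
Lemma deriv_XnM_neq0 (k : fieldType) n (p : {poly k}) :
  n%:R != 0 :> k -> ~~ root p 0 -> ('X^n * p)^`() != 0.
Proof.
case: n => [|n]; rewrite ?eqxx // => n0 p0; apply: contraNneq p0.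
have -> : ('X^(n.+1) * p)^`() = 'X^n * (p *+ n.+1 + 'X * p^`()).
  by rewrite derivM derivXn /= exprS mulrDr mulrnAl mulrnAr mulrA [_ * 'X]mulrC.
move/eqP; rewrite mulf_eq0 expf_eq0 polyX_eq0 andbF /= => /eqP.
move/(congr1 (horner^~ 0)).
rewrite hornerD hornerM hornerX mul0r addr0 horner0 hornerMn -mulr_natl.
by move/eqP; rewrite mulf_eq0 (negbTE n0).
Qed.

(** In units of max(deg g, deg h), the sum bounds the degree of the product of the earlier
    cofactors, and d^n + 1, counted twice, bounds deg g + deg h + deg H_(n+1). *)
Lemma nonprimitive_bound d n : (5 < d)%N ->
  (2 * d ^ n + 2 + \sum_(i < n.+1) (d ^ i).-1 <= (d ^ n.+1).-1)%N.
Proof.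
move=> d_gt5; elim: n => [|n IH].
  by rewrite big_ord_recr big_ord0 /= expn1; lia.
rewrite big_ord_recr /=; move: IH; rewrite !expnS.
have : (0 < d ^ n)%N by rewrite expn_gt0; lia.
move: (\sum_(i < _) _)%N (d ^ n)%N => s x x_gt0 IH.
have : (6 * (d * x) <= d * (d * x))%N by rewrite leq_mul2r d_gt5 orbT.
have : (x <= d * x)%N by rewrite leq_pmull //; lia.
by move: (d * (d * x))%N (d * x)%N IH => z y; lia.
Qed.

(** Here [a], [b], [c] are the degrees of g, h, H_(n+1), with x = d^n and m = d^(n+1) - 1.
    Cancellation in the Mason-Stothers inequality leaves q + M < a + b + c + D; doubling it and
    using D <= 2q + N gives m delta < (2x + 2 + s) delta. *)
Lemma mason_degrees_contra d m x s a b c q D N delta M :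
    (1 < d)%N -> (0 < m)%N -> (0 < x)%N ->
    (D <= 2 * q + N)%N -> (N <= s * delta)%N -> (2 * x + 2 + s <= m)%N ->
    (b <= delta)%N -> (a <= delta)%N -> (c <= x.-1 * delta)%N ->
    (D <= m * delta)%N -> (m * delta <= M)%N ->
  (d.-2 * a + d.-1 * c + m.-1 * b + q + M < d.-1 * a + d * c + m * b + D)%N ->
  False.
Proof.
case: d => [|[|d]] // _; case: m => // m _; case: x => // x _ /=.
rewrite !mulSn => leD leN le_m le_b le_a le_c leD' leM lt.
have := leq_mul le_m (leqnn delta); rewrite !mulnDl !mulSn -!mulnA !mulSn.
by move: (d * a)%N (d * c)%N (m * b)%N (m * delta)%N (s * delta)%N
         (x * delta)%N leD leN le_b le_a le_c leD' leM lt; lia.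
Qed.

Section PrimitivePrime.

Variables (k : finFieldType) (g h g1 : {poly k}) (d : nat).
Hypotheses (co_gh : coprimep g h) (gE : g = 'X * g1) (g1_0 : ~~ root g1 0).
Hypotheses (d_gt5 : (5 < d)%N) (dB1_neq0 : d.-1%:R != 0 :> k).

Local Notation H := (orbit_cofactor g h d).

(** If every prime factor of H_(n+2) were repeated or divided an earlier cofactor, H_(n+2) would
    share with its derivative a divisor too large for Mason-Stothers, applied to the two terms of
    its recursive definition. *)
Lemma simple_primitive_prime n : exists P, [/\ irreducible_poly P,
  P %| H n.+2, ~~ (P %| \prod_(i < n.+1) H i.+1) & ~~ (P ^+ 2 %| H n.+2)].
Proof.
have d_gt1 : (1 < d)%N by apply: leq_trans d_gt5.
have H0 (i : nat) : H i.+1 != 0 by exact: (orbit_cofactor_neq0 co_gh gE d_gt1).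
have g0 : g != 0 by apply: numer_neq0 gE g1_0.
set N := \prod_(i < n.+1) H i.+1.
have N0 : N != 0 by apply/prodf_neq0 => i _.
have [//|[Q [Q_D Q_dD leQ]]] := simple_factor_or_dvd_deriv (H0 n.+1) N0.
pose m := (d ^ n.+1).-1.
pose A := g ^+ d.-1 * H n.+1 ^+ d; pose B := h ^+ m.
have DE : H n.+2 = A + B by [].
have h0 : h != 0.
  by apply: contraNneq (denom_root0 co_gh gE) => ->; rewrite root0.
have coAB : coprimep A B.
  rewrite coprimep_expr // coprimepMl !coprimep_expl // coprimep_sym.
  exact: coprime_orbit_cofactor_den.
have AE : A = 'X^(d.-1) * (g1 ^+ d.-1 * H n.+1 ^+ d).
  by rewrite /A gE exprMn mulrA.
have dA0 : A^`() != 0.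
  rewrite AE deriv_XnM_neq0 // rootE hornerM !horner_exp mulf_eq0 !expf_eq0.
  rewrite -!rootE (negbTE g1_0) andbF /= negb_and.
  by rewrite (orbit_cofactor_root0 co_gh gE) ?orbT.
have A_dvd : g ^+ d.-2 * H n.+1 ^+ d.-1 %| A.
  by rewrite dvdp_mul ?dvdp_exp2l ?leq_pred.
have A_dvd' : g ^+ d.-2 * H n.+1 ^+ d.-1 %| A^`().
  rewrite derivM dvdp_add // ?dvdp_mul ?dvdp_exp2l ?leq_pred // deriv_exp.
    by rewrite -mulrnAl dvdp_mull.
  by rewrite -mulrnAl dvdp_mull.
have B_dvd : h ^+ m.-1 %| B by rewrite dvdp_exp2l ?leq_pred.
have B_dvd' : h ^+ m.-1 %| B^`() by rewrite deriv_exp -mulrnAl dvdp_mull.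
have B0 : B != 0 by rewrite expf_neq0.
have := mason_stothers coAB dA0 B0 (H0 n.+1) A_dvd A_dvd' B_dvd B_dvd' Q_D Q_dD.
have := deg_orbit_terms co_gh gE g1_0 d_gt1 n; rewrite -/m -/A -/B.
have := deg_orbit_cofactor co_gh gE g1_0 d_gt1 n.+1; rewrite -/m DE.
have := deg_orbit_cofactor co_gh gE g1_0 d_gt1 n.
have := leq_maxl (deg g) (deg h); have := leq_maxr (deg g) (deg h).
have leN : (deg N <= (\sum_(i < n.+1) (d ^ i).-1) * maxn (deg g) (deg h))%N.
  rewrite big_distrl /=.
  suff [] : N != 0 /\ (deg N <= \sum_(i < n.+1)
      (d ^ i).-1 * maxn (deg g) (deg h))%N by [].
  rewrite /N; apply: (big_ind2 (fun (p : {poly k}) (a : nat) =>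
    p != 0 /\ (deg p <= a)%N)) => [|p a q b|i _].
  - by rewrite oner_eq0 size_poly1.
  - by move=> [p0 IHp] [q0 IHq]; rewrite mulf_neq0 // deg_mul // leq_add.
  - by rewrite H0; split=> //; apply: deg_orbit_cofactor co_gh gE g1_0 d_gt1 _.
have := nonprimitive_bound n d_gt5.
rewrite -/m.
have -> : deg A = (d.-1 * deg g + d * deg (H n.+1))%N.
  by rewrite deg_mul ?expf_neq0 // !deg_exp.
have -> : deg (g ^+ d.-2 * H n.+1 ^+ d.-1) =
    (d.-2 * deg g + d.-1 * deg (H n.+1))%N.
  by rewrite deg_mul ?expf_neq0 // !deg_exp.
rewrite !deg_exp; move: leQ leN; rewrite DE.
have m_gt0 : (0 < m)%N.
  by rewrite /m -ltnS prednK ?expn_gt0 1?(ltnW d_gt1) // -(exp1n n.+1) ltn_exp2r.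
have x_gt0 : (0 < d ^ n)%N by rewrite expn_gt0 (ltnW d_gt1).
by move=> le1 le2 le3 le4 le5 le6 le7 le8 le9; case: (mason_degrees_contra d_gt1
  m_gt0 x_gt0 le1 le2 le3 le4 le5 le6 le7 le8 le9).
Qed.

Lemma primitive_prime n : exists P, [/\ irreducible_poly P, ~~ (P %| h),
  forall r, (r < n)%N -> ~~ (P %| g * H r.+1)
  & exists2 U, g * H n.+1 = P * U & ~~ (P %| U)].
Proof.
have d_gt1 : (1 < d)%N by apply: leq_trans d_gt5.
case: n => [|n].
  (* The first point of the orbit is C = g/h. Writing ['X] as ['X - 0] turns divisibility into
     evaluation at 0. *)
  exists 'X; rewrite -['X]subr0 !dvdp_XsubCl; split=> //.
  - exact: irredp_XsubC.
  - exact: denom_root0 co_gh gE.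
  by exists g1; rewrite ?dvdp_XsubCl // orbit_cofactor1 // mulr1 subr0.
have [P [irr_P P_H P_N P2_H]] := simple_primitive_prime n.
have P_dvd p q : coprimep p q -> P %| p -> ~~ (P %| q).
  move=> co_pq P_p; rewrite -irreducible_poly_coprime //.
  exact: coprimep_dvdr P_p co_pq.
have P_g : ~~ (P %| g).
  apply: P_dvd P_H; rewrite coprimep_sym.
  exact: coprime_orbit_cofactor_num co_gh d_gt1 _.
exists P; split=> //.
- apply: P_dvd P_H; rewrite coprimep_sym.
  exact: coprime_orbit_cofactor_den co_gh d_gt1 _.
- move=> r le_rn; rewrite irreducible_dvdM // (negbTE P_g) /=.
  apply: contra P_N => P_Hr; rewrite (bigD1 (Ordinal le_rn)) //=.
  exact: dvdp_mulr.
have /dvdpP[V HV] := P_H; exists (g * V); first by rewrite HV mulrA mulrC.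
rewrite irreducible_dvdM // (negbTE P_g) /=; apply: contra P2_H => P_V.
by rewrite HV expr2 mulrC dvdp_mul.
Qed.

End PrimitivePrime.

(** * Integrality at a prime *)

Section PIntegral.

Variables (k : fieldType) (P : {poly k}) (L : fieldType).
Variable iota : {rmorphism {poly k} -> L}.
Hypotheses (irr_P : irreducible_poly P) (inj_iota : injective iota).
Implicit Types (a b s : {poly k}) (x y : L).

(** The integral closure in [L] of the localization of k[t] at [P]. All primes above [P] are treated
    at once, so none has to be chosen. *)
Definition p_integral x :=
  exists2 s, ~~ (P %| s) & integralOver iota (iota s * x).

Let P_not1 : ~~ (P %| 1).
Proof. by rewrite dvdp1 neq_ltn irr_P.1 orbT. Qed.

Let P_notM a b : ~~ (P %| a) -> ~~ (P %| b) -> ~~ (P %| a * b).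
Proof.
by move=> Pa Pb; rewrite Gauss_dvdpr // irreducible_poly_coprime.
Qed.

Lemma p_integral_iota a : p_integral (iota a).
Proof. by exists 1; rewrite // rmorph1 mul1r; apply: integral_id. Qed.

Lemma p_integral0 : p_integral 0.
Proof. by rewrite -(rmorph0 iota); apply: p_integral_iota. Qed.

Lemma p_integral1 : p_integral 1.
Proof. by rewrite -(rmorph1 iota); apply: p_integral_iota. Qed.

Lemma p_integralM x y : p_integral x -> p_integral y -> p_integral (x * y).
Proof.
move=> [s Ps int_x] [s' Ps' int_y]; exists (s * s'); first exact: P_notM.
by rewrite rmorphM mulrACA; apply: integral_mul.
Qed.

Lemma p_integralD x y : p_integral x -> p_integral y -> p_integral (x + y).
Proof.
move=> [s Ps int_x] [s' Ps' int_y]; exists (s * s'); first exact: P_notM.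
rewrite rmorphM mulrDr {1}[iota s * _]mulrC -!mulrA.
by apply: integral_add; apply: integral_mul => //; apply: integral_id.
Qed.

Lemma p_integralN x : p_integral x -> p_integral (- x).
Proof.
by rewrite -mulN1r -(rmorph1 iota) -rmorphN; apply/p_integralM/p_integral_iota.
Qed.

Lemma p_integralB x y : p_integral x -> p_integral y -> p_integral (x - y).
Proof. by move=> px py; apply: p_integralD => //; apply: p_integralN. Qed.

Lemma p_integral_sum (I : Type) (r : seq I) (Q : pred I) (f : I -> L) :
  (forall i, Q i -> p_integral (f i)) -> p_integral (\sum_(i <- r | Q i) f i).
Proof. exact: (big_ind _ p_integral0 p_integralD). Qed.

Lemma p_integral_prod (I : Type) (r : seq I) (Q : pred I) (f : I -> L) :
  (forall i, Q i -> p_integral (f i)) -> p_integral (\prod_(i <- r | Q i) f i).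
Proof. exact: (big_ind _ p_integral1 p_integralM). Qed.

Lemma p_integralX n x : p_integral x -> p_integral (x ^+ n).
Proof.
move=> px; elim: n => [|n IH]; first exact: p_integral1.
by rewrite exprS; apply: p_integralM.
Qed.

(** Integral closures are integrally closed: [iota s * x] is a root of X^n - (s x)^n, which is monic
    with integral coefficients. *)
Lemma p_integral_root n x : (0 < n)%N -> p_integral (x ^+ n) -> p_integral x.
Proof.
case: n => // n _ [s Ps int_x]; exists s => //.
have int_xn : integralOver iota ((iota s * x) ^+ n.+1).
  rewrite exprMn exprSr -mulrA -rmorphXn.
  by apply: integral_mul => //; apply: integral_id.
apply: (@integral_root_monic _ _ iota _ ('X^(n.+1) - ((iota s * x) ^+ n.+1)%:P)).
- by apply: monicXnsubC.
- by rewrite rootE !hornerE subrr.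
move=> c /(nthP 0)[i _ <-]; rewrite coefB coefXn coefC.
apply: integral_sub; first exact: integral_nat.
by case: ifP => _; [exact: int_xn | exact: integral0].
Qed.

Lemma p_integral_invr s : ~~ (P %| s) -> p_integral (iota s)^-1.
Proof.
move=> Ps; exists s => //; rewrite divff; first exact: integral1.
rewrite -(rmorph0 iota) (inj_eq inj_iota).
by apply: contraNneq Ps => ->; apply: dvdp0.
Qed.

(** k[t] is integrally closed, by the rational root argument: for a fraction in lowest terms,
    clearing denominators in a monic equation shows that the denominator divides a power of the
    numerator, so it is constant. *)
Lemma integral_fraction a b : b != 0 ->
  integralOver iota (iota a / iota b) -> exists c, iota a / iota b = iota c.
Proof.
move=> b0 [p mon_p root_p].
have i0 c : c != 0 -> iota c != 0.
  by rewrite -(rmorph0 iota) (inj_eq inj_iota).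
have [a1 [b1 [g [Da Db co_ab g0 b10]]]] := coprime_cofactors a b0.
have fracE : iota a / iota b = iota a1 / iota b1.
  by rewrite Da Db !rmorphM /= -mulf_div divff ?mulr1 // i0.
have b1_unit : size b1 == 1%N.
  pose n := (size p).-1.
  have sz_p : size p = n.+1 by rewrite /n prednK // size_poly_gt0 monic_neq0.
  have : \sum_(i < n.+1) p`_i * a1 ^+ i * b1 ^+ (n - i) = 0.
    apply: inj_iota; rewrite rmorph0 rmorph_sum /=.
    have /rootP := root_p; rewrite fracE horner_coef size_map_poly_id0; last first.
      by rewrite (monicP mon_p) rmorph1 oner_neq0.
    rewrite sz_p => /(congr1 ( *%R^~ (iota b1 ^+ n))); rewrite mul0r big_distrl /=.
    move=> sum0; rewrite -[RHS]sum0; apply: eq_bigr => i _.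
    rewrite coef_map !rmorphM /= !rmorphXn.
    have le_in : (i <= n)%N by rewrite -ltnS.
    rewrite -[X in _ = _ * _ ^+ X](subnKC le_in) exprD expr_div_n -!mulrA.
    by congr (_ * (_ * _)); rewrite mulrA mulVf ?mul1r // expf_neq0 ?i0.
  rewrite big_ord_recr /= subnn mulr1 => /eqP; rewrite addr_eq0 => /eqP sumE.
  have : b1 %| p`_n * a1 ^+ n.
    rewrite -dvdpNr -sumE; elim/big_ind: _ => [|p1 p2|i _].
    - exact: dvdp0.
    - exact: dvdp_add.
    apply: dvdp_mull.
    by rewrite -(subnSK (ltn_ord i)) exprS dvdp_mulr.
  have -> : p`_n = 1 by have := monicP mon_p; rewrite lead_coefE sz_p.
  rewrite mul1r -[a1 ^+ n]mulr1 Gauss_dvdpr ?dvdp1 //.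
  by rewrite coprimep_expr // coprimep_sym.
have /size_poly1P[c c0 Db1] := b1_unit.
have ic0 : iota c%:P != 0 by rewrite i0 ?polyC_eq0.
exists (c^-1 *: a1); rewrite fracE Db1 -mul_polyC rmorphM /= mulrC.
congr (_ * _); apply: (mulfI ic0).
by rewrite mulfV // -rmorphM -polyCM mulfV // rmorph1.
Qed.

Lemma p_integral_fraction a b : b != 0 -> p_integral (iota a / iota b) ->
  exists c s, ~~ (P %| s) /\ iota s * (iota a / iota b) = iota c.
Proof.
move=> b0 [s Ps]; rewrite mulrA -rmorphM => int_x.
have [c xE] := integral_fraction b0 int_x.
by exists c, s; rewrite mulrA -rmorphM.
Qed.

(** The source of the final contradiction: 1/P = c/s would give s = P c. *)
Lemma p_integral_iotaP_inv : ~ p_integral (iota P)^-1.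
Proof.
have P0 := irredp_neq0 irr_P.
have iP0 : iota P != 0 by rewrite -(rmorph0 iota) (inj_eq inj_iota).
rewrite -[_^-1]mul1r -(rmorph1 iota) => /(p_integral_fraction P0)[c [s [Ps]]].
rewrite rmorph1 mul1r => /(canRL (mulfVK iP0)); rewrite -rmorphM => /inj_iota Ds.
by case/negP: Ps; rewrite Ds dvdp_mull.
Qed.

(** The local ring of the base field modulo [P] is reduced: once denominators prime to [P] are
    cleared, [P] divides a power of a polynomial, hence the polynomial itself. Traces are brought
    back to this case. *)
Lemma p_integral_div_root n a b : b != 0 -> (0 < n)%N ->
  p_integral ((iota a / iota b) ^+ n / iota P) ->
  p_integral (iota a / iota b / iota P).
Proof.
move=> b0 n0 int_xn; set x := iota a / iota b in int_xn *.
have P0 := irredp_neq0 irr_P.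
have iP0 : iota P != 0 by rewrite -(rmorph0 iota) (inj_eq inj_iota).
have is0 s : ~~ (P %| s) -> iota s != 0.
  rewrite -(rmorph0 iota) (inj_eq inj_iota).
  by apply: contraNneq => ->; apply: dvdp0.
have /(p_integral_fraction b0)[c [s [Ps xE]]] : p_integral x.
  apply: (p_integral_root n0); rewrite -(divfK iP0 (x ^+ n)).
  by apply: p_integralM => //; apply: p_integral_iota.
rewrite -/x in xE.
have bnP0 : b ^+ n * P != 0 by rewrite mulf_neq0 ?expf_neq0.
have xnP : iota (a ^+ n) / iota (b ^+ n * P) = x ^+ n / iota P.
  by rewrite /x expr_div_n !rmorphM !rmorphXn /= invfM mulrA.
have : p_integral (iota (a ^+ n) / iota (b ^+ n * P)) by rewrite xnP.
move=> /(p_integral_fraction bnP0)[c' [s' [Ps']]]; rewrite xnP => xnE.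
have : P %| s' * c ^+ n.
  have : s' * c ^+ n = s ^+ n * (P * c').
    apply: inj_iota; rewrite !rmorphM !rmorphXn -xE -xnE exprMn.
    by rewrite [iota P * _]mulrC -!mulrA mulVf // mulr1 mulrCA.
  by move->; rewrite dvdp_mull // dvdp_mulr.
rewrite irreducible_dvdM // (negbTE Ps') irreducible_dvdX // n0 /= => /dvdpP[c1 Dc].
have -> : x / iota P = iota c1 / iota s.
  apply: (mulfI (is0 s Ps)).
  by rewrite mulrA xE Dc rmorphM mulfK // mulrCA divff ?mulr1 ?is0.
by apply: p_integralM; [apply: p_integral_iota | apply: p_integral_invr].
Qed.

Lemma p_integral_morph (f : {rmorphism L -> L}) x :
  (forall a, f (iota a) = iota a) -> p_integral x -> p_integral (f x).
Proof.
move=> f_iota [s Ps [p mon_p root_p]]; exists s => //; exists p => //.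
rewrite -[iota s]f_iota -rmorphM.
have <- : map_poly f (map_poly iota p) = map_poly iota p.
  by apply/polyP => i; rewrite !coef_map /= f_iota.
by rewrite mapf_root.
Qed.

End PIntegral.

(** * Extensions unramified at a prime of k[t] *)

Lemma coprime_fraction (k : fieldType) (x : {fraction {poly k}}) :
  exists a b, [/\ b != 0, coprimep a b & x = tofrac a / tofrac b].
Proof.
set r := generic_quotient.repr x.
have d0 : \d_r != 0 by exact: denom_ratioP.
have xdE : x * tofrac \d_r = tofrac \n_r.
  rewrite -[x]generic_quotient.reprK -/r; unlock FracField.tofrac.
  rewrite -[LHS]FracField.pi_mul; apply/eqmodP.
  rewrite /= FracField.equivfE /FracField.mulf !numden_Ratio ?mulr1 ?oner_eq0 //.
  by rewrite mulrC.
move: \n_r \d_r d0 xdE => a b b0 xbE.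
have [a1 [b1 [g [Da Db co_ab g0 b10]]]] := coprime_cofactors a b0.
exists a1, b1; split=> //; apply: (canRL (mulfK _)); first by rewrite tofrac_eq0.
apply: (@mulIf _ (tofrac g)); first by rewrite tofrac_eq0.
by rewrite -mulrA -!tofracM -Da -Db.
Qed.

Section Unramified.

Variables (k : fieldType) (P : {poly k}).
Variable L : splittingFieldType {fraction {poly k}}.
Hypothesis irr_P : irreducible_poly P.

Definition poly_in : {poly k} -> L := in_alg L \o @tofrac {poly k}.
HB.instance Definition _ := GRing.RMorphism.on poly_in.

Lemma poly_in_inj : injective poly_in.
Proof. by move=> a b /fmorph_inj /eqP; rewrite tofrac_eq => /eqP. Qed.

Lemma in_alg_fraction x a b :
  x = tofrac a / tofrac b -> in_alg L x = poly_in a / poly_in b.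
Proof. by move->; rewrite fmorph_div. Qed.

Lemma base_fraction (x : L) : x \in 1%VS ->
  exists a b, b != 0 /\ x = poly_in a / poly_in b.
Proof.
case/vlineP => c ->; have [a [b [b0 _ ->]]] := coprime_fraction c.
by exists a, b; rewrite -in_algE fmorph_div.
Qed.

Local Notation pint := (p_integral P poly_in).

Variables (E : {subfield L}) (p : nat).
Hypotheses (galE : galois 1 E) (pcharL : p \in [pchar L]).

Lemma gal_poly_in (s : gal_of E) a : s (poly_in a) = poly_in a.
Proof. by rewrite /poly_in /= linearZ /= rmorph1. Qed.

Lemma p_integral_gal (s : gal_of E) x : pint x -> pint (s x).
Proof. by apply: p_integral_morph => //; apply: gal_poly_in. Qed.


(* This says that the ring of p-integral elements of [E] is unramified over the
   local ring at [P]. *)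
Hypothesis separating : forall s : gal_of E, s \in 'Gal(E / 1%AS)%g -> s != 1%g ->
  exists b, [/\ b \in E, pint b, b != s b & pint (b - s b)^-1].

(** The dual family that characterizes Galois extensions of rings: the sum of the x s(y) is 1 for s
    = 1 and 0 for the listed s. To kill one more [s], the sum of the tensors of x and y is modified
    so that its value at each t is multiplied by (t(b) - s(b)) / (b - s(b)), which is 1 at the
    identity and 0 at [s]. *)
Lemma dual_family (ss : seq (gal_of E)) :
    {subset ss <= 'Gal(E / 1%AS)%g} -> 1%g \notin ss ->
  exists2 xy : seq (L * L),
    forall z, z \in xy -> [/\ pint z.1, pint z.2 & z.2 \in E] &
    \sum_(z <- xy) z.1 * z.2 = 1 /\
    {in ss, forall s : gal_of E, \sum_(z <- xy) z.1 * s z.2 = 0}.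
Proof.
elim: ss => [|s ss IH] gal_ss ss1.
  exists [:: (1, 1)]; last by rewrite big_seq1 mulr1.
  by move=> z; rewrite inE => /eqP->; split; rewrite ?rpred1 //; apply: p_integral1.
move: ss1; rewrite inE negb_or eq_sym => /andP[s1 ss1].
have [|//|xy int_xy [xy1 xy0]] := IH.
  by move=> t ss_t; apply: gal_ss; rewrite inE ss_t orbT.
have [|b [Eb int_b neq_b int_bV]] := separating (gal_ss s _) s1.
  by rewrite inE eqxx.
have b_neq0 : b - s b != 0 by rewrite subr_eq0.
have int_sb : pint (s b) by apply: p_integral_gal.
pose f z := (z.1 / (b - s b), b * z.2) : L * L.
pose g z := (- s b / (b - s b) * z.1, z.2) : L * L.
exists (map f xy ++ map g xy) => [z|].
  rewrite mem_cat => /orP[] /mapP[z' /int_xy[int1 int2 Ez] ->] /=; split=> //.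
  - exact: p_integralM.
  - exact: p_integralM.
  - exact: rpredM.
  - by apply: p_integralM => //; apply: p_integralM => //; apply: p_integralN.
have sumE (t : gal_of E) :
    \sum_(z <- map f xy ++ map g xy) z.1 * t z.2 =
    (t b - s b) / (b - s b) * \sum_(z <- xy) z.1 * t z.2.
  rewrite big_cat !big_map /= !big_distrr -big_split /=; apply: eq_bigr => z _.
  rewrite rmorphM !mulrDl mulNr; congr (_ + _); last by rewrite -mulrA.
  by rewrite [z.1 / _]mulrC mulrACA [_^-1 * _]mulrC.
split.
  have := sumE 1%g; rewrite gal_id divff // mul1r.
  under eq_bigr do rewrite gal_id.
  by under [in RHS]eq_bigr do rewrite gal_id; move->.
move=> t; rewrite inE => /orP[/eqP->|ss_t]; rewrite sumE.
  by rewrite subrr !mul0r.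
by rewrite xy0 // mulr0.
Qed.

Lemma pchar_sumX (I : Type) (r : seq I) (Q : pred I) (f : I -> L) n :
  (\sum_(i <- r | Q i) f i) ^+ (p ^ n) = \sum_(i <- r | Q i) f i ^+ (p ^ n).
Proof.
have p_gt0 : (0 < p ^ n)%N by rewrite expn_gt0 prime_gt0 ?(pcharf_prime pcharL).
apply: (big_morph (fun x => x ^+ (p ^ n))) => [x y|]; last by rewrite expr0n gtn_eqF.
apply: exprDn_pchar; rewrite pnatX; apply/orP; left.
by rewrite (eq_pnat _ (pcharf_eq pcharL)) pnat_id // (pcharf_prime pcharL).
Qed.

(* Frobenius commutes with the trace, so nilpotency modulo [P] passes to traces,
   which lie in the base, and back to [x] through the dual family. *)
Lemma p_integral_reduced n x : x \in E -> (0 < n)%N ->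
  pint (x ^+ n / poly_in P) -> pint (x / poly_in P).
Proof.
move=> Ex n_gt0 int_xn.
have iP0 : poly_in P != 0.
  by rewrite -(rmorph0 poly_in) (inj_eq poly_in_inj) irredp_neq0.
have int_P : pint (poly_in P) by apply: p_integral_iota.
have int_x : pint x.
  apply: (p_integral_root n_gt0).
  by rewrite -[x ^+ n](divfK iP0); apply: p_integralM.
have [||xy int_xy [xy1 xy0]] :=
  @dual_family [seq s <- enum 'Gal(E / 1%AS)%g | s != 1%g].
- by move=> s; rewrite mem_filter mem_enum => /andP[].
- by rewrite mem_filter eqxx.
(* When the traces are expanded, the coefficient of s(x) is the sum of the [z.1 * s z.2], which is 1
   for the identity and 0 otherwise. *)
have xE : x = \sum_(z <- xy) z.1 * galTrace 1%AS E (x * z.2).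
  under eq_bigr do rewrite /galTrace big_distrr /=.
  rewrite exchange_big /= (bigD1 1%g) ?group1 //= [X in _ + X]big1 ?addr0.
    under eq_bigr do rewrite gal_id mulrCA.
    by rewrite -big_distrr /= xy1 mulr1.
  move=> s /andP[gal_s s1]; under eq_bigr do rewrite rmorphM mulrCA.
  by rewrite -big_distrr /= xy0 ?mulr0 // mem_filter s1 mem_enum.
have int_tr y : y \in E -> pint y ->
    pint (galTrace 1%AS E (x * y) / poly_in P).
  move=> Ey int_y.
  have [a [b [b0 trE]]] := base_fraction (mem_galTrace galE (rpredM Ex Ey)).
  have p_gt1 := prime_gt1 (pcharf_prime pcharL).
  (* The exponent p^n exceeds [n], so [P] divides (x y)^(p^n); raising to this power also commutes
     with the sum of conjugates. *)
  rewrite trE; apply: (@p_integral_div_root _ _ _ _ irr_P poly_in_inj (p ^ n)) => //.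
    by rewrite expn_gt0 ltnW.
  rewrite -trE pchar_sumX big_distrl /=; apply: p_integral_sum => // s _.
  rewrite -rmorphXn -(gal_poly_in s) -fmorphV -rmorphM; apply: p_integral_gal.
  have powE N : (n <= N)%N -> (x * y) ^+ N / poly_in P =
      x ^+ (N - n) * (x ^+ n / poly_in P) * y ^+ N.
    by move=> le_nN; rewrite mulrA -exprD subnK // exprMn mulrAC.
  rewrite powE; last exact: ltnW (ltn_expl n p_gt1).
  apply: p_integralM => //; last exact: p_integralX.
  by apply: p_integralM => //; exact: p_integralX.
rewrite xE big_distrl /= big_seq.
apply: p_integral_sum => // z /int_xy[int1 int2 Ez].
by rewrite -mulrA; apply: p_integralM => //; apply: int_tr.
Qed.

Section Radical.

Variables (S : finType) (w : S -> L) (v : L).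
Hypotheses (Ew : forall s, w s \in E) (int_w : forall s, pint (w s)).
Hypothesis w_sep : forall s s', s != s' -> w s != w s' /\ pint (w s - w s')^-1.
Hypotheses (v_neq0 : v != 0) (int_v : pint v) (int_vV : pint v^-1).
Hypothesis prod_w : \prod_s w s = poly_in P * v.

(* [w s0] and the product of the other factors are comaximal, and [P] divides
   their product exactly once, so a [d]-th power in which [w s0] occurs with an
   exponent prime to [d] forces [P] to divide the other factors. *)
Lemma p_integral_inv_of_radical d (y : S -> nat) z s0 :
    (0 < y s0 < d)%N -> z \in E -> z ^+ d = \prod_s w s ^+ y s ->
  pint (w s0)^-1.
Proof.
move=> /andP[y_gt0 y_ltd] Ez zE.
have iP0 : poly_in P != 0.
  by rewrite -(rmorph0 poly_in) (inj_eq poly_in_inj) irredp_neq0.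
have int_P : pint (poly_in P) by apply: p_integral_iota.
have d_gt0 : (0 < d)%N by apply: leq_ltn_trans y_ltd.
have w0 s : w s != 0.
  have : \prod_s w s != 0 by rewrite prod_w mulf_neq0.
  by apply: contraNneq => ws0; rewrite (bigD1 s) //= ws0 mul0r.
pose W := \prod_(s | s != s0) w s.
pose T := \prod_(s | s != s0) w s ^+ y s.
have wW : w s0 * W = poly_in P * v by rewrite -prod_w (bigD1 s0).
have int_W : pint W by apply: p_integral_prod.
have int_T : pint T by apply: p_integral_prod => // s _; apply: p_integralX.
have EW : W \in E by apply: rpred_prod.
(* [U] is what remains of (z W)^d once the factor (w s0 * W)^(y s0) = (P v)^(y s0) is split off. *)
pose U := W ^+ (d - y s0) * T.
have int_U : pint U by apply: p_integralM => //; apply: p_integralX.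
have zWE : (z * W) ^+ d = (poly_in P * v) ^+ y s0 * U.
  rewrite exprMn zE (bigD1 s0) //= -/T -wW exprMn /U -(subnKC (ltnW y_ltd)) exprD.
  by rewrite -!mulrA; congr (_ * _); rewrite mulrC -!mulrA addKn.
(* As [y s0] is positive, [P] divides (z W)^d, hence z W because [E] is unramified at [P]. *)
have int_zW : pint (z * W / poly_in P).
  apply: (@p_integral_reduced d) => //; first exact: rpredM.
  have -> : (z * W) ^+ d / poly_in P = v * (poly_in P * v) ^+ (y s0).-1 * U.
    by rewrite zWE -{1}(prednK y_gt0) exprS; field.
  apply: p_integralM => //; apply: p_integralM => //; apply: p_integralX => //.
  exact: p_integralM.
(* Now P^d divides (z W)^d, and the factor (P v)^(y s0) absorbs only [y s0] < [d] copies of [P]: at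
   least one is left for [U]. *)
have int_UP : pint (U / poly_in P).
  have -> : U / poly_in P =
      poly_in P ^+ (d - y s0).-1 * (z * W / poly_in P) ^+ d * v^-1 ^+ y s0.
    rewrite expr_div_n zWE exprMn.
    have -> : poly_in P ^+ d =
        poly_in P ^+ y s0 * poly_in P ^+ (d - y s0).-1 * poly_in P.
      by rewrite -mulrA -exprSr -exprD prednK ?subn_gt0 // subnKC // ltnW.
    rewrite exprVn; move: (v ^+ _) (poly_in P ^+ _) (poly_in P ^+ _)
      (expf_neq0 (y s0) v_neq0) (expf_neq0 (y s0) iP0)
      (expf_neq0 (d - y s0).-1 iP0) => V A B V0 A0 B0.
    by field; rewrite ?V0 ?A0 ?B0 ?iP0.
  apply: p_integralM => //; last exact: p_integralX.
  by apply: p_integralM => //; exact: p_integralX.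
(* [U] is a product of factors [w s] with [s] different from [s0], each invertible modulo [w s0]
   because [w s - w s0] is a unit. *)
have [u [r [int_u int_r uE]]] :
    exists u r, [/\ pint u, pint r & U * u = 1 + w s0 * r].
  pose coprime_w x := exists u r, [/\ pint u, pint r & x * u = 1 + w s0 * r].
  have coM x1 x2 : coprime_w x1 -> coprime_w x2 -> coprime_w (x1 * x2).
    move=> [u1 [r1 [int_u1 int_r1 u1E]]] [u2 [r2 [int_u2 int_r2 u2E]]].
    exists (u1 * u2), (r1 + r2 + w s0 * r1 * r2); split.
    - exact: p_integralM.
    - apply: p_integralD => //; first exact: p_integralD.
      by apply: p_integralM => //; apply: p_integralM.
    - by rewrite mulrACA u1E u2E; ring.
  have co1 : coprime_w 1.
    exists 1, 0; rewrite mulr0 mulr1 addr0.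
    by split=> //; [apply: p_integral1 | apply: p_integral0].
  have coX x n : coprime_w x -> coprime_w (x ^+ n).
    by move=> co_x; elim: n => [|n IH] //; rewrite exprS; apply: coM.
  have co_w s : s != s0 -> coprime_w (w s).
    move=> /w_sep[]; rewrite -subr_eq0 => ws0 int_wV.
    exists (w s - w s0)^-1, (w s - w s0)^-1; split=> //.
    by rewrite -{1}(subrK (w s0) (w s)) mulrDl mulfV.
  apply/coM; first exact/coX/(big_ind coprime_w co1 coM co_w).
  by apply: (big_ind coprime_w co1 coM) => s s_s0; exact/coX/co_w.
clearbody U.
(* [P] divides [U], and [w s0] divides [P] up to the unit [v]; with U u = 1 + w s0 r, this makes
   [w s0] a divisor of 1. *)
have -> : (w s0)^-1 = W * v^-1 * (U / poly_in P) * u - r.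
  apply: (mulfI (w0 s0)); rewrite divff // mulrBr.
  apply/eqP; rewrite eq_sym subr_eq -uE !mulrA wW; apply/eqP.
  by field; rewrite v_neq0 iP0.
by apply: p_integralB => //; do 3?[apply: p_integralM => //].
Qed.

Lemma not_all_p_integral_inv : ~ (forall s, pint (w s)^-1).
Proof.
move=> int_wV; apply: (p_integral_iotaP_inv irr_P poly_in_inj).
have -> : (poly_in P)^-1 = v * \prod_s (w s)^-1.
  by rewrite prodfV prod_w invfM mulrCA mulfV // mulr1.
by apply: p_integralM => //; apply: p_integral_prod.
Qed.

End Radical.
End Unramified.

(** * Kummer theory *)

Section Annihilator.

Variables (S : finType) (d : nat).
Hypothesis d_gt1 : (1 < d)%N.

Local Notation V := {ffun S -> 'Z_d}.

(** Orthogonality of characters: translation by [b], being injective, permutes the finite set [A],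
    and it multiplies the sum by z^(f b), which is not 1. *)
Lemma sum_char_eq0 (z : algC) (A : {set V}) (f : V -> 'Z_d) b :
    d.-primitive_root z -> {morph f : x y / x + y} ->
    (forall x y, x \in A -> y \in A -> x + y \in A) -> b \in A -> f b != 0 ->
  \sum_(a in A) z ^+ f a = 0.
Proof.
move=> prim_z fD A_D A_b fb0.
have zD (x y : 'Z_d) : z ^+ (x + y)%R = z ^+ x * z ^+ y.
  by rewrite -exprD /= [X in (_ %% X)%N](Zp_cast d_gt1) (prim_expr_mod prim_z).
have A_b_inj a : a + b \in A -> a \in A.
  have /eqP AE : [set (x : V) + b | x in A] == A.
    rewrite eqEcard card_imset ?leqnn ?andbT; last exact: addIr.
    by apply/subsetP => _ /imsetP[x Ax ->]; apply: A_D.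
  by rewrite -{1}AE => /imsetP[x Ax /addIr->].
have zfb : z ^+ f b != 1.
  rewrite -(expr0 z) (eq_prim_root_expr prim_z) mod0n modn_small //.
  by rewrite -[X in (_ < X)%N](Zp_cast d_gt1) ltn_ord.
apply: (mulfI (_ : z ^+ f b - 1 != 0)); first by rewrite subr_eq0.
rewrite mulr0 mulrBl mul1r; apply/eqP; rewrite subr_eq0 big_distrr /=; apply/eqP.
rewrite [RHS](reindex_inj (addIr b)) /=; apply: eq_big => [a | a _].
  by apply/idP/idP => [Aa | /A_b_inj //]; apply: A_D.
by rewrite fD zD mulrC.
Qed.

(* Double count the sum of [z ^+ (y . a)] over all [y] and all [a] in [A]. *)
Lemma eq_setT_of_annihilator (A : {set V}) :
    0 \in A -> (forall x y, x \in A -> y \in A -> x + y \in A) ->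
    (forall y : V, {in A, forall a : V, \sum_s y s * a s = 0} -> y = 0) ->
  A = [set: V].
Proof.
move=> A0 A_D annA; apply/eqP; rewrite eqEcard subsetT cardsT /=.
have [z prim_z] := C_prim_root_exists (ltnW d_gt1).
pose dot (y a : V) := \sum_s y s * a s.
have dotDl a : {morph dot^~ a : x y / x + y}.
  move=> x y; rewrite /dot -big_split; apply: eq_bigr => s _.
  by rewrite ffunE mulrDl.
have dotDr y : {morph dot y : a b / a + b}.
  move=> a b; rewrite /dot -big_split; apply: eq_bigr => s _.
  by rewrite ffunE mulrDr.
have : \sum_(y : V) \sum_(a in A) z ^+ dot y a = #|A|%:R.
  rewrite (bigD1 (0 : V)) //= [X in _ + X]big1 ?addr0 => [|y y0].
    rewrite -sum1_card natr_sum; apply: eq_bigr => a _.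
    by rewrite /dot big1 // => s _; rewrite ffunE mul0r.
  have [b Ab dot_b] : exists2 b, b \in A & dot y b != 0.
    apply/exists_inP; apply: contraNT y0; rewrite negb_exists_in.
    move/forall_inP => dot0; apply/eqP/annA => a Aa.
    by apply/eqP; have := dot0 a Aa; rewrite negbK.
  exact: sum_char_eq0 prim_z (dotDr y) A_D Ab dot_b.
rewrite exchange_big (bigD1 (0 : V)) //= [X in _ + X]big1 ?addr0 => [|a /andP[_ a0]].
  under eq_bigr => y _.
    rewrite (_ : dot y 0 = 0); last first.
      by rewrite /dot big1 // => s _; rewrite ffunE mulr0.
  over.
  by rewrite sumr_const => /eqP; rewrite Num.Theory.eqr_nat => /eqP->.
have [s a_s] : exists s, a s != 0.
  apply/existsP; apply: contraNT a0; rewrite negb_exists => /forallP a0.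
  by apply/eqP/ffunP => s; rewrite ffunE; apply/eqP; have := a0 s; rewrite negbK.
(* A coordinate vector detects a nonzero [a], so the character attached to [a] is nontrivial on the
   whole group. *)
pose e : V := [ffun s' => (s' == s)%:R].
have dot_e : dot e a != 0.
  rewrite /dot (bigD1 s) //= ffunE eqxx mul1r big1 ?addr0 // => s' s's.
  by rewrite ffunE (negbTE s's) mul0r.
have A_T x y : x \in [set: V] -> y \in [set: V] -> x + y \in [set: V].
  by rewrite !in_setT.
rewrite -[RHS](sum_char_eq0 prim_z (dotDl a) A_T (in_setT e) dot_e).
by apply: eq_bigl => y; rewrite in_setT.
Qed.

End Annihilator.

Section Kummer.

Variables (F : fieldType) (L : splittingFieldType F) (E M : {subfield L}).
Variables (S : finType) (d : nat) (zeta : L) (rho : S -> L).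
Hypotheses (galEM : galois E M) (d_gt1 : (1 < d)%N).
Hypotheses (prim_zeta : d.-primitive_root zeta) (E_zeta : zeta \in E).
Hypotheses (M_rho : forall s, rho s \in M) (rho_neq0 : forall s, rho s != 0).
Hypothesis E_rhoX : forall s, rho s ^+ d \in E.

(** An automorphism over [E] multiplies each [rho s] by a power of [zeta], and the exponent vectors
    form a subset of (Z/d)^S closed under addition. If y is orthogonal to all of them, the product
    of the [rho s ^+ y s] is fixed, so it lies in [E] and y = 0. By duality every vector occurs. *)
Lemma kummer_full :
    (forall y : S -> nat, (forall s, y s < d)%N ->
       \prod_s rho s ^+ y s \in E -> forall s, y s = 0%N) ->
  forall a : S -> nat, exists2 t : gal_of M, t \in 'Gal(M / E)%g &
    forall s, t (rho s) = zeta ^+ a s * rho s.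
Proof.
move=> indep a.
have sEM : (E <= M)%VS by have /andP[] := galEM.
have ZpD (x y : 'Z_d) : (x + y)%R = ((x + y) %% d)%N :> nat.
  by rewrite /= [X in (_ %% X)%N](Zp_cast d_gt1).
have inZpE n : (inZp n : 'Z_d) = (n %% d)%N :> nat.
  by rewrite /= [X in (_ %% X)%N](Zp_cast d_gt1).
have t_zeta (t : gal_of M) n : t \in 'Gal(M / E)%g -> t (zeta ^+ n) = zeta ^+ n.
  by move=> gal_t; apply: (fixed_gal sEM gal_t); apply: rpredX.
pose cocycle (t : gal_of M) (b : {ffun S -> 'Z_d}) :=
  [forall s, t (rho s) == zeta ^+ b s * rho s].
have ex_cocycle (t : gal_of M) : t \in 'Gal(M / E)%g -> exists b, cocycle t b.
  move=> gal_t.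
  have ex_b s : exists i : 'Z_d, t (rho s) == zeta ^+ i * rho s.
    have : (t (rho s) / rho s) ^+ d = 1.
      have := fixed_gal sEM gal_t (E_rhoX s); rewrite rmorphXn /= => t_rhoX.
      by rewrite expr_div_n t_rhoX divff ?expf_neq0.
    move/(prim_rootP prim_zeta) => [i Di]; exists (inZp i).
    by rewrite /= (Zp_cast d_gt1) modn_small // -Di divfK.
  exists [ffun s => xchoose (ex_b s)]; apply/forallP => s; rewrite ffunE.
  exact: (xchooseP (ex_b s)).
pose A := [set b | [exists t in 'Gal(M / E)%g, cocycle t b]].
have A0 : 0 \in A.
  rewrite inE; apply/exists_inP; exists 1%g; rewrite ?group1 //.
  by apply/forallP => s; rewrite gal_id ffunE mul1r.
have zetaE (x y : nat) : (x = y %[mod d])%N -> zeta ^+ x = zeta ^+ y.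
  by move/eqP; rewrite -(eq_prim_root_expr prim_zeta) => /eqP.
have A_D x y : x \in A -> y \in A -> x + y \in A.
  rewrite !inE => /exists_inP[t gal_t /forallP tx] /exists_inP[u gal_u /forallP uy].
  apply/exists_inP; exists (t * u)%g; first by rewrite groupM.
  apply/forallP => s; rewrite ffunE galM // (eqP (tx s)) // rmorphM /= t_zeta //.
  rewrite (eqP (uy s)) mulrA -exprD; apply/eqP; congr (_ * _); apply: zetaE.
  by rewrite -modn_mod -ZpD.
have AT : A = setT.
  apply: (eq_setT_of_annihilator d_gt1 A0 A_D) => y ann_y.
  have y_lt s : (y s < d)%N by rewrite -[X in (_ < X)%N](Zp_cast d_gt1) ltn_ord.
  suff y0 : forall s, y s = 0%N :> nat.
    by apply/ffunP => s; rewrite ffunE; apply: val_inj; rewrite /= y0.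
  apply: indep => //.
  suff : \prod_s rho s ^+ y s \in fixedField 'Gal(M / E)%g.
    by rewrite (galois_fixedField galEM).
  apply/fixedFieldP.
    by apply: rpred_prod => s _; apply: rpredX.
  move=> t gal_t; have [b tb] := ex_cocycle t gal_t.
  have Ab : b \in A by rewrite inE; apply/exists_inP; exists t.
  rewrite rmorph_prod /=.
  under eq_bigr => s _.
    rewrite rmorphXn /= (eqP (forallP tb s)) exprMn -exprM mulnC.
  over.
  (* The product is multiplied by [zeta] to the power y . b, which is 0 modulo [d]. *)
  rewrite big_split /= prodrXr (zetaE _ 0%N) ?expr0 ?mul1r //.
  rewrite mod0n -(val_Zp_nat d_gt1) natr_sum.
  under eq_bigr do rewrite natrM !natr_Zp.
  by rewrite ann_y.
pose b : {ffun S -> 'Z_d} := [ffun s => inZp (a s)].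
have : b \in A by rewrite AT inE.
rewrite inE => /exists_inP[t gal_t /forallP tb]; exists t => // s.
rewrite (eqP (tb s)) ffunE; congr (_ * _); apply: zetaE.
by rewrite inZpE modn_mod.
Qed.

End Kummer.

(** * Iterates of a unicritical polynomial *)

Lemma iter_polyD (R : comNzRingType) (g : {poly R}) i j :
  iter_poly (i + j) g = iter_poly i g \Po iter_poly j g.
Proof.
elim: i => [|i IH]; first by rewrite comp_polyX.
by rewrite addSn /iter_poly !iterS -!/(iter_poly _ _) IH comp_polyA.
Qed.

Lemma map_iter_poly (R S : comNzRingType) (f : {rmorphism R -> S}) (g : {poly R}) j :
  map_poly f (iter_poly j g) = iter_poly j (map_poly f g).
Proof.
elim: j => [|j IH]; first by rewrite map_polyX.
by rewrite /iter_poly !iterS -!/(iter_poly _ _) map_comp_poly IH.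
Qed.

Section Unicritical.

Variables (L : fieldType) (d : nat) (c zeta : L).
Hypotheses (d_gt1 : (1 < d)%N) (prim_zeta : d.-primitive_root zeta).

Local Notation T := (fun x : L => x ^+ d + c).
Local Notation G := ('X^d + c%:P).

Let d_gt0 : (0 < d)%N. Proof. exact: ltnW. Qed.

Lemma horner_iter_unicritical j x : (iter_poly j G).[x] = iter j T x.
Proof.
elim: j => [|j IH]; first by rewrite hornerX.
by rewrite /iter_poly !iterS -!/(iter_poly _ _) horner_comp IH !hornerE.
Qed.

Lemma size_iter_unicritical j : size (iter_poly j G) = (d ^ j).+1.
Proof.
have szG : size G = d.+1 by rewrite size_XnaddC.
have degE : (size (iter_poly j G)).-1 = (d ^ j)%N.
  elim: j => [|j IH]; first by rewrite size_polyX.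
  by rewrite /iter_poly iterS -!/(iter_poly _ _) size_comp_poly szG IH expnS.
rewrite -degE prednK // lt0n; apply/eqP => sz0.
by move: degE; rewrite sz0 => /esym/eqP; rewrite expn_eq0 eqn0Ngt d_gt0.
Qed.

Lemma iter_unicritical_monic j : iter_poly j G \is monic.
Proof.
elim: j => [|j IH]; first exact: monicX.
rewrite monicE /iter_poly iterS -!/(iter_poly _ _) lead_coef_comp; last first.
  by rewrite size_iter_unicritical ltnS expn_gt0 d_gt0.
by rewrite (monicP IH) expr1n mulr1 -monicE monicXnaddC.
Qed.

(** As F^j has degree d^j, the cardinality makes [lam] a labelling of all its roots, which are then
    simple. *)
Definition all_iter_roots (S : finType) (lam : S -> L) j :=
  [/\ injective lam, forall s, iter j T (lam s) = 0 & #|S| = (d ^ j)%N].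

Lemma all_iter_roots_prod (S : finType) (lam : S -> L) j :
  all_iter_roots lam j -> iter_poly j G = \prod_s ('X - (lam s)%:P).
Proof.
move=> [inj_lam root_lam cardS].
rewrite [LHS](@all_roots_prod_XsubC _ _ [seq lam s | s : S]).
- by rewrite big_image /= (monicP (iter_unicritical_monic j)) scale1r.
- by rewrite size_iter_unicritical size_image cardS.
- by apply/allP => _ /imageP[s _ ->]; rewrite rootE horner_iter_unicritical root_lam.
- by rewrite uniq_rootsE map_inj_uniq // enum_uniq.
Qed.

Lemma all_iter_roots_horner (S : finType) (lam : S -> L) j x :
  all_iter_roots lam j -> iter j T x = \prod_s (x - lam s).
Proof.
move=> /all_iter_roots_prod prodE; rewrite -horner_iter_unicritical prodE.
by rewrite horner_prod; apply: eq_bigr => s _; rewrite hornerXsubC.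
Qed.

Hypothesis orbit_neq0 : forall j, iter j.+1 T 0 != 0.

(** A root of F^j equal to [c] would give F^(j+1)(0) = F^j(c) = 0. This keeps the d-th roots of
    [x - c] away from 0. *)
Lemma iter_root_neq_c j x : iter j T x = 0 -> x != c.
Proof.
move=> Tx0; apply: contra_eq_neq Tx0 => ->.
by have := orbit_neq0 j; rewrite iterSr expr0n gtn_eqF // add0r.
Qed.

Lemma all_iter_roots0 : all_iter_roots (fun _ : unit => 0) 0.
Proof. by split=> [[] []|[]|]; rewrite ?card_unit. Qed.

Definition child (S : Type) (rho : S -> L) (sx : S * 'Z_d) :=
  zeta ^+ sx.2 * rho sx.1.

Lemma all_iter_rootsS (S : finType) (lam rho : S -> L) j :
  all_iter_roots lam j -> (forall s, rho s ^+ d + c = lam s) ->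
  all_iter_roots (child rho) j.+1.
Proof.
move=> [inj_lam root_lam cardS] rhoE.
have childE sx : T (child rho sx) = lam sx.1.
  by rewrite /child exprMn exprAC (prim_expr_order prim_zeta) expr1n mul1r rhoE.
have rho0 s : rho s != 0.
  apply: contraNneq (iter_root_neq_c (root_lam s)) => rho0.
  by rewrite -rhoE rho0 expr0n gtn_eqF // add0r.
split=> [[s x] [s' x'] eq_child|sx|].
- have ss' : s = s' by apply: inj_lam; rewrite -(childE (s, x)) eq_child childE.
  move: eq_child; rewrite -ss' => /(mulIf (rho0 s))/eqP.
  rewrite (eq_prim_root_expr prim_zeta) /= !modn_small; last 2 first.
  - by rewrite -[X in (_ < X)%N](Zp_cast d_gt1) ltn_ord.
  - by rewrite -[X in (_ < X)%N](Zp_cast d_gt1) ltn_ord.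
  by move=> /eqP/val_inj->.
- by rewrite iterSr childE root_lam.
by rewrite card_prod cardS card_ord Zp_cast // expnSr.
Qed.

End Unicritical.

Section IntegralRoots.

Variables (k : fieldType) (P : {poly k}) (L : fieldType).
Variable iota : {rmorphism {poly k} -> L}.
Hypotheses (irr_P : irreducible_poly P) (inj_iota : injective iota).
Variables (d : nat) (c : L) (z : k).
Hypotheses (d_gt1 : (1 < d)%N) (prim_z : d.-primitive_root z).

Local Notation T := (fun x : L => x ^+ d + c).
Local Notation pint := (p_integral P iota).

Hypothesis int_c : pint c.

Lemma p_integral_iter_root j x : iter j T x = 0 -> pint x.
Proof.
elim: j x => [|j IH] x; first by move=> /= ->; apply: p_integral0.
rewrite iterSr => /IH int_Tx; apply: (p_integral_root (ltnW d_gt1)).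
by rewrite -(addrK c (x ^+ d)); apply: p_integralB.
Qed.

Lemma p_integral_iter_sub j x y : pint x -> pint y ->
  exists2 r, pint r & iter j T x - iter j T y = (x - y) * r.
Proof.
elim: j x y => [|j IH] x y int_x int_y.
  by exists 1; [apply: p_integral1 | rewrite mulr1].
have int_T u : pint u -> pint (T u).
  by move=> int_u; apply: p_integralD => //; apply: p_integralX.
have [r int_r] := IH _ _ (int_T x int_x) (int_T y int_y); rewrite -!iterSr => ->.
have -> : x ^+ d + c - (y ^+ d + c) = x ^+ d - y ^+ d by ring.
rewrite subrXX -mulrA; eexists; last by [].
apply: p_integralM => //; apply: p_integral_sum => // i _.
by apply: p_integralM => //; apply: p_integralX.
Qed.

Lemma p_integral_inv_sub x y r u :
  pint r -> u != 0 -> pint u^-1 -> u = (x - y) * r -> pint (x - y)^-1.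
Proof.
move=> int_r u0 int_uV uE.
have : (x - y) * r != 0 by rewrite -uE.
rewrite mulf_eq0 negb_or => /andP[xy0 r0].
have -> : (x - y)^-1 = r * u^-1 by rewrite uE invfM mulrCA divff // mulr1.
exact: p_integralM.
Qed.

(** If F(x) and F(y) differ, [x - y] divides their difference, a unit by induction. Otherwise y =
    z^i x, and x - y is [x] times a nonzero constant. *)
Lemma p_integral_inv_sub_roots j x y :
    (forall i, (i < j)%N -> iter i.+1 T 0 != 0 /\ pint (iter i.+1 T 0)^-1) ->
  iter j T x = 0 -> iter j T y = 0 -> x != y -> pint (x - y)^-1.
Proof.
elim: j x y => [|j IH] x y orbit_unit; first by move=> /= -> ->; rewrite eqxx.
move=> Tx0 Ty0 neq_xy; rewrite !iterSr in Tx0 Ty0.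
have int_x : pint x by apply: (@p_integral_iter_root j.+1); rewrite iterSr.
have int_y : pint y by apply: (@p_integral_iter_root j.+1); rewrite iterSr.
have [eq_T | neq_T] := eqVneq (T x) (T y); last first.
  have [r int_r TE] := p_integral_iter_sub 1 int_x int_y.
  apply: (p_integral_inv_sub int_r _ _ TE); first by rewrite subr_eq0.
  by apply: IH => // i lt_ij; apply/orbit_unit/leqW.
have [a0 int_aV] := orbit_unit j (leqnn _).
(* [x] divides F^(j+1)(x) - F^(j+1)(0) = - F^(j+1)(0), which is a unit. *)
have x0 : x != 0 /\ pint x^-1.
  have [r int_r TE] := p_integral_iter_sub j.+1 int_x (p_integral0 iota irr_P).
  rewrite iterSr Tx0 sub0r subr0 in TE.
  have : x * r != 0 by rewrite -TE oppr_eq0.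
  rewrite mulf_eq0 negb_or => /andP[xn0 r0]; split=> //.
  rewrite -[x]subr0; apply: (p_integral_inv_sub int_r _ _ _); last first.
  - by rewrite subr0; apply: TE.
  - by rewrite invrN; apply: p_integralN.
  - by rewrite oppr_eq0.
have [xn0 int_xV] := x0.
have zeta_prim : d.-primitive_root (iota z%:P).
  by rewrite (fmorph_primitive_root (iota \o polyC)).
have : (y / x) ^+ d = 1.
  by rewrite expr_div_n -(addrK c (y ^+ d)) -eq_T addrK divff // expf_neq0.
move=> /(prim_rootP zeta_prim)[i yE].
have -> : x - y = x * iota (1 - z ^+ i)%:P.
  by rewrite polyCB polyC1 rmorphB rmorph1 polyC_exp rmorphXn -yE; field.
have zi1 : 1 - z ^+ i != 0.
  apply: contraNneq neq_xy => zi1; rewrite -subr_eq0.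
  have -> : x - y = x * iota (1 - z ^+ i)%:P.
    by rewrite polyCB polyC1 rmorphB rmorph1 polyC_exp rmorphXn -yE; field.
  by rewrite zi1 polyC0 rmorph0 mulr0.
rewrite invfM; apply: p_integralM => //; apply: p_integral_invr => //.
apply/negP => /dvdp_leq; rewrite polyC_eq0 size_polyC zi1 => /(_ isT).
by rewrite leqNgt irr_P.1.
Qed.

End IntegralRoots.

(** * Kummer independence at each level of the tower *)

Lemma gal_eq1_gen (F : fieldType) (L : splittingFieldType F) (E : {subfield L})
    (rs : seq L) (t : gal_of E) :
  <<1 & rs>>%VS = E -> {in rs, forall x, t x = x} -> t = 1%g.
Proof.
move=> genE t_rs; apply/eqP/gal_eqP => x Ex; rewrite gal_id.
suff /subvP/(_ x Ex)/fixedFieldP : (E <= fixedField [set t])%VS.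
  by move=> /(_ Ex)/(_ t); apply; rewrite inE.
rewrite -{1}genE; apply/Fadjoin_seqP; split=> [|y rs_y]; first exact: sub1v.
have Ey : y \in E by rewrite -genE; apply: seqv_sub_adjoin.
by apply/fixedFieldP => // s; rewrite inE => /eqP->; apply: t_rs.
Qed.

Section Tower.

Variables (k : finFieldType) (g h g1 : {poly k}) (d p : nat) (z : k).
Hypotheses (co_gh : coprimep g h) (gE : g = 'X * g1) (g1_0 : ~~ root g1 0).
Hypotheses (d_gt5 : (5 < d)%N) (dB1_neq0 : d.-1%:R != 0 :> k).
Hypotheses (prim_z : d.-primitive_root z).
Variable L : splittingFieldType {fraction {poly k}}.
Hypothesis pcharL : p \in [pchar L].

Local Notation iota := (@poly_in k L).
Variable c : L.
Hypothesis cE : c = iota g / iota h.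
Local Notation zeta := (iota z%:P).
Local Notation T := (fun x : L => x ^+ d + c).
Local Notation G := ('X^d + c%:P).
Local Notation H := (orbit_cofactor g h d).

Let d_gt1 : (1 < d)%N. Proof. exact: leq_trans d_gt5. Qed.

Let prim_zeta : d.-primitive_root zeta.
Proof. by rewrite (fmorph_primitive_root (iota \o polyC)). Qed.

Let iota_neq0 a : a != 0 -> iota a != 0.
Proof. by rewrite -(rmorph0 iota) (inj_eq (@poly_in_inj k L)). Qed.

Let h_neq0 : h != 0.
Proof. by apply: contraNneq (denom_root0 co_gh gE) => ->; rewrite root0. Qed.

Lemma critical_orbit_fraction j :
  iter j.+1 T 0 = iota (g * H j.+1) / iota h ^+ (d ^ j).
Proof.
have ih0 : iota h != 0 by apply: iota_neq0.
apply: (canRL (mulfK (expf_neq0 _ ih0))).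
elim: j => [|j IH].
  rewrite orbit_cofactor1 // mulr1 expn0 expr1 /= expr0n gtn_eqF ?(ltnW d_gt1) //.
  by rewrite add0r cE divfK.
rewrite iterS orbit_cofactorS // rmorphD rmorphXn /= -IH mulrDl.
congr (_ + _); first by rewrite exprMn -exprM expnSr.
have : (0 < d ^ j.+1)%N by rewrite expn_gt0 (ltnW d_gt1).
case: (d ^ j.+1)%N => // m _ /=.
by rewrite cE rmorphM rmorphXn /= exprS mulrA divfK.
Qed.

Lemma critical_orbit_neq0 j : iter j.+1 T 0 != 0.
Proof.
rewrite critical_orbit_fraction mulf_neq0 ?invr_eq0 ?expf_neq0 ?iota_neq0 //.
by rewrite mulf_neq0 ?(numer_neq0 gE) ?(orbit_cofactor_neq0 co_gh gE).
Qed.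

Lemma base_c : c \in 1%VS.
Proof. by rewrite cE rpred_div //; apply: rpredZ; apply: rpred1. Qed.

Lemma all_iter_roots_galois (S : finType) (lam : S -> L) j :
  all_iter_roots d c lam j -> galois 1 <<1 & codom lam>>.
Proof.
move=> lam_roots; have := all_iter_roots_prod d_gt1 lam_roots.
have -> : \prod_s ('X - (lam s)%:P) = \prod_(x <- codom lam) ('X - x%:P).
  by rewrite big_image.
move=> prodE.
apply/splitting_galoisField; exists (iter_poly j G); split.
- elim: j {lam_roots prodE} => [|j IH]; first exact: polyOverX.
  apply: polyOver_comp IH; rewrite rpredD ?rpredX ?polyOverX //.
  by rewrite polyOverC base_c.
- rewrite prodE separable_prod_XsubC map_inj_uniq ?enum_uniq //.
  by case: lam_roots.
by exists (codom lam); rewrite // prodE eqpxx.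
Qed.

Lemma gal_c (E : {subfield L}) (t : gal_of E) : t c = c.
Proof. by have /vlineP[a ->] := base_c; rewrite linearZ rmorph1. Qed.

Lemma gal_iter (E : {subfield L}) (t : gal_of E) j x :
  t (iter j T x) = iter j T (t x).
Proof. by elim: j => //= j <-; rewrite rmorphD rmorphXn /= gal_c. Qed.

Section Level.

Variables (M : {subfield L}) (S : finType) (lam rho : S -> L) (j : nat).
Hypotheses (galM : galois 1 M) (lam_roots : all_iter_roots d c lam j).
Hypotheses (M_rho : forall s, rho s \in M) (rhoE : forall s, rho s ^+ d + c = lam s).
Hypothesis trans : forall s s',
  exists2 t : gal_of M, t \in 'Gal(M / 1%AS)%g & t (lam s) = lam s'.

Let E := <<1 & codom lam>>%AS.

Let E_lam s : lam s \in E.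
Proof. by apply: seqv_sub_adjoin; apply: codom_f. Qed.

Let E_c : c \in E.
Proof. by apply: (subvP (sub1v E)); apply: base_c. Qed.

Let rhoX s : rho s ^+ d = lam s - c.
Proof. by rewrite -rhoE addrK. Qed.

Let root_lam s : iter j T (lam s) = 0.
Proof. by case: lam_roots => _ ->. Qed.

(** The local argument at the prime [P] supplied by [primitive_prime] at index [j]: a nonzero
    exponent makes one [lam s - c] a unit at [P], transitivity makes all of them units, yet their
    product is [P] times a unit. *)
Lemma kummer_independent (y : S -> nat) :
    (forall s, y s < d)%N -> \prod_s rho s ^+ y s \in E ->
  forall s, y s = 0%N.
Proof.
move=> y_lt Ey s0; apply/eqP; apply: contraT; rewrite -lt0n => y_gt0.
have [P [irr_P P_h P_G [U GE P_U]]] :=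
  primitive_prime co_gh gE g1_0 d_gt5 dB1_neq0 j.
have int_inv a : ~~ (P %| a) -> p_integral P iota (iota a)^-1.
  by apply: p_integral_invr; apply: poly_in_inj.
have int_iota a : p_integral P iota (iota a) by apply: p_integral_iota.
have int_c : p_integral P iota c.
  by rewrite cE; apply: p_integralM => //; apply: int_inv.
have orbit_unit i : (i < j)%N ->
    iter i.+1 T 0 != 0 /\ p_integral P iota (iter i.+1 T 0)^-1.
  move=> lt_ij; split; first exact: critical_orbit_neq0.
  rewrite critical_orbit_fraction invfM invrK mulrC.
  apply: p_integralM => //; last by apply: int_inv; apply: P_G.
  exact: p_integralX.
have lam_sep := p_integral_inv_sub_roots irr_P (@poly_in_inj k L) d_gt1 prim_z
  int_c orbit_unit.
have galE : galois 1 E := all_iter_roots_galois lam_roots.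
(* A nontrivial automorphism moves some root of F^j, and the difference of two distinct roots is a
   unit at [P]. *)
have separating (t : gal_of E) : t \in 'Gal(E / 1%AS)%g -> t != 1%g ->
    exists b, [/\ b \in E, p_integral P iota b, b != t b
                & p_integral P iota (b - t b)^-1].
  move=> gal_t t1.
  have [s neq_s] : exists s, lam s != t (lam s).
    apply/existsP; apply: contraNT t1; rewrite negb_exists => /forallP t_lam.
    apply/eqP/(gal_eq1_gen (rs := codom lam)) => // _ /codomP[s ->].
    by apply/eqP; rewrite eq_sym; have := t_lam s; rewrite negbK.
  exists (lam s); split=> //; first exact: p_integral_iter_root (root_lam s).
  apply: lam_sep neq_s; first exact: root_lam.
  by apply: etrans (esym (gal_iter t j (lam s))) _; rewrite root_lam rmorph0.
pose w s := lam s - c.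
pose v := (-1) ^+ #|S| * (iota U / iota h ^+ (d ^ j)).
have h0 : iota h != 0 by apply: iota_neq0.
have U0 : iota U != 0.
  by apply: iota_neq0; apply: contraNneq P_U => ->; apply: dvdp0.
have v0 : v != 0 by rewrite mulf_neq0 ?signr_eq0 // mulf_neq0 ?invr_eq0 ?expf_neq0.
have int_sign : p_integral P iota ((-1) ^+ #|S|).
  by apply: p_integralX => //; apply: p_integralN => //; apply: p_integral1.
have int_v : p_integral P iota v.
  apply: p_integralM => //; apply: p_integralM => //.
  by rewrite -exprVn; apply: p_integralX => //; apply: int_inv.
have int_vV : p_integral P iota v^-1.
  rewrite /v !invfM invrK -exprVn invrN1; apply: p_integralM => //.
  apply: p_integralM => //; first exact: int_inv.
  by apply: p_integralX.
(* The product of the [c - lam s] is F^j(c) = F^(j+1)(0); [v] collects the sign, the cofactor [U]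
   and the denominator. *)
have prod_w : \prod_s w s = iota P * v.
  have := critical_orbit_fraction j.
  rewrite iterSr expr0n gtn_eqF ?(ltnW d_gt1) // add0r.
  rewrite (all_iter_roots_horner d_gt1 c lam_roots) GE rmorphM /= => prodE.
  have -> : \prod_s w s = (-1) ^+ #|S| * \prod_s (c - lam s).
    rewrite -prodr_const -big_split; apply: eq_bigr => s _ /=.
    by rewrite mulN1r opprB.
  by rewrite prodE /v -mulrA mulrCA.
have int_w s : p_integral P iota (w s).
  by apply: p_integralB => //; apply: p_integral_iter_root (root_lam s).
have w_sep s s' : s != s' ->
    w s != w s' /\ p_integral P iota (w s - w s')^-1.
  have [inj_lam _ _] := lam_roots => neq_s.
  have neq_lam : lam s != lam s' by rewrite (inj_eq inj_lam).
  rewrite /w (inj_eq (addIr _)) opprB addrA subrK; split=> //.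
  by apply: lam_sep neq_lam; apply: root_lam.
have Ew s : w s \in E by apply: rpredB.
have zE : (\prod_s rho s ^+ y s) ^+ d = \prod_s w s ^+ y s.
  rewrite -prodrXl; apply: eq_bigr => s _.
  by rewrite -exprM mulnC exprM rhoX.
have y_range : (0 < y s0 < d)%N by rewrite y_gt0 y_lt.
have int_wV0 := p_integral_inv_of_radical irr_P galE pcharL separating
  Ew int_w w_sep v0 int_v int_vV prod_w y_range Ey zE.
case: (not_all_p_integral_inv irr_P v0 int_v prod_w) => s.
(* Conjugation carries the unit [w s0] to any other [w s]. *)
have [t _ t_s] := trans s0 s.
have -> : (w s)^-1 = t (w s0)^-1 by rewrite fmorphV rmorphB /= gal_c t_s.
exact: p_integral_gal.
Qed.

(** Since lam s = rho s ^ d + c, the field [E] lies in [M]. Kummer theory then applies to [M] over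
    [E], whose automorphisms also fix the base. *)
Lemma kummer_level (a : S -> nat) :
  exists2 t : gal_of M, t \in 'Gal(M / 1%AS)%g &
    forall s, t (rho s) = zeta ^+ a s * rho s.
Proof.
have sEM : (E <= M)%VS.
  apply/Fadjoin_seqP; split=> [|_ /codomP[s ->]]; first exact: sub1v.
  by rewrite -rhoE rpredD ?rpredX // (subvP (sub1v M)) ?base_c.
have galEM : galois E M by apply: galoisS galM; rewrite sub1v.
have rho0 s : rho s != 0.
  apply: contraNneq (iter_root_neq_c d_gt1 critical_orbit_neq0 (root_lam s)).
  by rewrite -rhoE => ->; rewrite expr0n gtn_eqF ?add0r // ltnW.
have [|s|t gal_t tE] := kummer_full galEM d_gt1 prim_zeta _ M_rho rho0 _
  kummer_independent a.
- by apply: (subvP (sub1v E)); apply: rpredZ; apply: rpred1.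
- by rewrite rhoX rpredB.
by exists t => //; apply: subsetP gal_t; apply: galS; apply: sub1v.
Qed.

End Level.

End Tower.

(** * The wreath product action *)

Section Wreath.

Variables (F : fieldType) (L : splittingFieldType F) (M : {subfield L}).
Variables (d n : nat) (c zeta : L).
Hypotheses (d_gt1 : (1 < d)%N) (prim_zeta : d.-primitive_root zeta).
Hypotheses (base_c : c \in 1%VS) (base_zeta : zeta \in 1%VS).

Local Notation T := (fun x : L => x ^+ d + c).

Hypothesis orbit_neq0 : forall j, iter j.+1 T 0 != 0.
Hypothesis M_children : forall j x, (j < n)%N -> iter j T x = 0 ->
  exists2 y, y \in M & y ^+ d + c = x.
Hypothesis kummer : forall (S : finType) (lam rho : S -> L) j,
    all_iter_roots d c lam j ->
    (forall s, rho s \in M) -> (forall s, rho s ^+ d + c = lam s) ->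
    (forall s s', exists2 t : gal_of M,
       t \in 'Gal(M / 1%AS)%g & t (lam s) = lam s') ->
  forall a : S -> nat, exists2 t : gal_of M, t \in 'Gal(M / 1%AS)%g &
    forall s, t (rho s) = zeta ^+ a s * rho s.

(** The Galois group and [W] induce the same permutations of the labelled roots. The homomorphism
    itself is recovered in [realized_isog], where the roots generate [M]. *)
Definition action_realized (W : finGroupType) (S : finType)
    (to : {action W &-> S}) (lam : S -> L) :=
  (forall t : gal_of M, t \in 'Gal(M / 1%AS)%g ->
     exists w, forall s, t (lam s) = lam (to s w)) /\
  (forall w, exists2 t : gal_of M, t \in 'Gal(M / 1%AS)%g &
     forall s, t (lam s) = lam (to s w)).

Definition action_transitive (W : finGroupType) (S : finType)
    (to : {action W &-> S}) := forall s s', exists w, to s w = s'.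

Let gal_base (t : gal_of M) x : x \in 1%VS -> t x = x.
Proof. by case/vlineP => a ->; rewrite linearZ rmorph1. Qed.

Let gal_zeta (t : gal_of M) i : t (zeta ^+ i) = zeta ^+ i.
Proof. by rewrite rmorphXn /= gal_base. Qed.

Let zetaD (x y : 'Z_d) : zeta ^+ (x * y)%g = zeta ^+ x * zeta ^+ y.
Proof.
by rewrite -exprD /= [X in (_ %% X)%N](Zp_cast d_gt1) (prim_expr_mod prim_zeta).
Qed.

Let same_power x y : y != 0 -> x ^+ d = y ^+ d -> exists b : 'Z_d, x = zeta ^+ b * y.
Proof.
move=> y0 xy; have : (x / y) ^+ d = 1 by rewrite expr_div_n xy divff ?expf_neq0.
move/(prim_rootP prim_zeta) => [i Di]; exists (inZp i).
by rewrite /= (Zp_cast d_gt1) (prim_expr_mod prim_zeta) -Di divfK.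
Qed.

Lemma wreath_elt (H : finGroupType) (S : finType) (to : {action H &-> S}) h
    (a : S -> 'Z_d) : exists w : wreath 'Z_d to,
  forall s x, wr_child_action 'Z_d to (s, x) w = (to s h, (x * a (to s h))%g).
Proof.
pose V := {dffun forall _ : S, 'Z_d}.
have hP : (h, [ffun s => a s] : V) \in setX [set: H]%G [set: V]%G.
  by rewrite !inE.
by exists (SdPair (wr_groupAction 'Z_d to) hP) => s x; rewrite /= /wr_child /= ffunE.
Qed.

Lemma wreath_transitive (H : finGroupType) (S : finType) (to : {action H &-> S}) :
  action_transitive to -> action_transitive (wr_child_action 'Z_d to).
Proof.
move=> trans [s x] [s' x']; have [h hE] := trans s s'.
have [w wE] := wreath_elt to h (fun=> (x^-1 * x')%g).
by exists w; rewrite wE hE mulKVg.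
Qed.

Lemma wreath_faithful (H : finGroupType) (S : finType) (to : {action H &-> S}) :
  (forall h, (forall s, to s h = s) -> h = 1%g) ->
  forall w, (forall sx, wr_child_action 'Z_d to sx w = sx) -> w = 1%g.
Proof.
move=> faith w w_id; apply: val_inj; case: w w_id => [[h a] ha] /= w_id.
have h1 : h = 1%g by apply: faith => s; have := w_id (s, 1%g); case.
congr pair => //; apply/ffunP => s; rewrite ffunE.
have := w_id (s, 1%g); rewrite /wr_child /= h1 act1 mul1g.
by case.
Qed.

(** An automorphism inducing [h] on the [lam s] sends [rho s] to a d-th root of [lam (to s h) - c],
    and the powers of [zeta] that appear are the coordinates of a wreath element. Conversely, any
    lift of [h] can be corrected by a Kummer automorphism to have prescribed coordinates. *)
Lemma wreath_realized (H : finGroupType) (S : finType) (to : {action H &-> S})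
    (lam rho : S -> L) j :
    all_iter_roots d c lam j -> (forall s, rho s \in M) ->
    (forall s, rho s ^+ d + c = lam s) -> action_transitive to ->
    action_realized to lam ->
  action_realized (wr_child_action 'Z_d to) (child zeta rho).
Proof.
move=> lam_roots M_rho rhoE trans_to [gal_act act_gal].
have [_ root_lam _] := lam_roots.
have rhoX s : rho s ^+ d = lam s - c by rewrite -rhoE addrK.
have rho0 s : rho s != 0.
  apply: contraNneq (iter_root_neq_c d_gt1 orbit_neq0 (root_lam s)).
  by rewrite -rhoE => ->; rewrite expr0n gtn_eqF ?add0r // ltnW.
have lift (t : gal_of M) h : (forall s, t (lam s) = lam (to s h)) ->
    exists b : S -> 'Z_d, forall s, t (rho s) = zeta ^+ b s * rho (to s h).
  move=> tE.
  have ex_b s : exists b : 'Z_d, t (rho s) == zeta ^+ b * rho (to s h).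
    have [|b ->] := @same_power (t (rho s)) (rho (to s h)) (rho0 _); last by exists b.
    by rewrite -rmorphXn /= !rhoX rmorphB /= tE gal_base.
  by exists (fun s => xchoose (ex_b s)) => s; apply/eqP; apply: (xchooseP (ex_b s)).
split=> [t gal_t | w].
  have [h hE] := gal_act t gal_t; have [b bE] := lift t h hE.
  (* A wreath element reads its coordinate at the image vertex, hence the shift by the inverse of
     [h]. *)
  have [w wE] := wreath_elt to h (fun s => b (to s h^-1%g)).
  exists w => -[s x]; rewrite wE /child /= rmorphM /= gal_zeta bE actK mulrA.
  by rewrite zetaD.
have trans_lam s s' :
    exists2 t : gal_of M, t \in 'Gal(M / 1%AS)%g & t (lam s) = lam s'.
  have [h hE] := trans_to s s'; have [t gal_t tE] := act_gal h.
  by exists t; rewrite // tE hE.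
case: w => [[h a] ha]; have [t gal_t tE] := act_gal h; have [b bE] := lift t h tE.
(* [u] replaces the exponents [b] of the lift [t] by the prescribed [a]; it acts after [t], so the
   correction sits at the image vertex. *)
have [u gal_u uE] := kummer lam_roots M_rho rhoE trans_lam
  (fun s => ((b (to s h^-1%g))^-1 * a s)%g).
exists (t * u)%g; first exact: groupM.
move=> [s x]; rewrite /child /wr_child /=.
rewrite galM; last by rewrite rpredM // (subvP (sub1v M)) // rpredX.
have key : zeta ^+ b s * zeta ^+ ((b s)^-1 * a (to s h))%g = zeta ^+ a (to s h).
  by rewrite -zetaD mulKVg.
rewrite rmorphM /= gal_zeta bE !rmorphM /= !gal_zeta uE actK.
by rewrite (zetaD x) -key !mulrA.
Qed.

(** Level one repeats the wreath step over the single root 0 of F^0 = X, with the trivial label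
    dropped. *)
Lemma cyclic_realized : (0 < n)%N -> exists2 lam : 'Z_d -> L,
  all_iter_roots d c lam 1 /\ (forall s, lam s \in M) & action_realized 'R%act lam.
Proof.
move=> n_gt0; have [y My yE] := M_children n_gt0 (erefl 0 : iter 0 T 0 = 0).
pose rho := fun _ : unit => y.
have roots1 : all_iter_roots d c (child (d := d) zeta rho) 1.
  by apply: (all_iter_rootsS d_gt1 prim_zeta orbit_neq0 (all_iter_roots0 d c)).
have y0 : y != 0.
  apply: contraNneq (iter_root_neq_c d_gt1 orbit_neq0 (erefl 0 : iter 0 T 0 = 0)).
  by move=> y_0; rewrite -yE y_0 expr0n gtn_eqF ?add0r // ltnW.
pose lam (x : 'Z_d) := child zeta rho (tt, x).
exists lam.
  have [inj_child root_child card_child] := roots1; split; last first.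
    by move=> x; rewrite rpredM ?rpredX // (subvP (sub1v M)).
  split=> [x x' /inj_child[] //|x|]; first exact: root_child.
  by rewrite -card_child card_prod card_unit mul1n.
have yX : y ^+ d = - c by apply/eqP; rewrite -subr_eq0 opprK yE.
split=> [t gal_t | w].
  have [|b bE] := @same_power (t y) y y0.
    by rewrite -rmorphXn /= yX rmorphN /= gal_base.
  exists b => x; rewrite /lam /child /= rmorphM /= gal_zeta bE mulrA.
  by rewrite -zetaD.
have [|t gal_t tE] :=
  kummer (all_iter_roots0 d c) (fun _ => My) (fun _ => yE) _ (fun=> w).
  by move=> [] []; exists 1%g; rewrite ?group1 ?gal_id.
exists t => // x; rewrite /lam /child /= rmorphM /= gal_zeta (tE tt) mulrA.
by rewrite -zetaD.
Qed.

Lemma cyclic_transitive : action_transitive ('R%act : {action 'Z_d &-> 'Z_d}).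
Proof. by move=> x x'; exists (x^-1 * x')%g; rewrite /= mulKVg. Qed.

(** The index is shifted: [tree_group d j] is W_(j+1) and labels the roots of F^(j+1). Transitivity
    is carried along because the Kummer step at the next level uses it. *)
Lemma tree_group_realized j : (j < n)%N ->
  exists2 lam : pg_set (tree_group d j) -> L,
    all_iter_roots d c lam j.+1 /\ (forall s, lam s \in M) &
    action_realized (pg_act (tree_group d j)) lam /\
    action_transitive (pg_act (tree_group d j)).
Proof.
elim: j => [|j IH] lt_jn.
  have [lam lam_roots lam_real] := cyclic_realized lt_jn.
  by exists lam => //; split=> //; apply: cyclic_transitive.
have [lam [lam_roots M_lam] [lam_real trans]] := IH (ltnW lt_jn).
have [_ root_lam _] := lam_roots.
have ex_rho s : exists y, (y \in M) && (y ^+ d + c == lam s).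
  have [y My yE] := M_children lt_jn (root_lam s).
  by exists y; rewrite My yE eqxx.
pose rho s := xchoose (ex_rho s).
have M_rho s : rho s \in M by have /andP[] := xchooseP (ex_rho s).
have rhoE s : rho s ^+ d + c = lam s by have /andP[_ /eqP] := xchooseP (ex_rho s).
exists (child zeta rho).
  split; first exact: (all_iter_rootsS d_gt1 prim_zeta orbit_neq0 lam_roots rhoE).
  by move=> s; rewrite rpredM ?rpredX // (subvP (sub1v M)).
split; first exact: wreath_realized lam_roots M_rho rhoE trans lam_real.
exact: wreath_transitive.
Qed.

Lemma tree_group_faithful j w :
  (forall s, pg_act (tree_group d j) s w = s) -> w = 1%g.
Proof.
elim: j w => [|j IH] w w_id; last exact: (wreath_faithful IH).
by have := w_id 1%g; rewrite /= mul1g.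
Qed.

(** An automorphism is determined by its effect on the generating roots, so the one attached to [w]
    is unique and the choice is multiplicative. Faithfulness gives injectivity; the first half of
    [action_realized] gives surjectivity. *)
Lemma realized_isog (W : finGroupType) (S : finType) (to : {action W &-> S})
    (lam : S -> L) :
    injective lam -> <<1 & codom lam>>%VS = M -> action_realized to lam ->
    (forall w, (forall s, to s w = s) -> w = 1%g) ->
  ('Gal(M / 1%AS) \isog [set: W])%g.
Proof.
move=> inj_lam genM [gal_act act_gal] faithful.
have M_lam s : lam s \in M by rewrite -genM; apply: seqv_sub_adjoin; apply: codom_f.
have gal_eq (t u : gal_of M) : (forall s, t (lam s) = u (lam s)) -> t = u.
  move=> tu; apply/eqP; rewrite eq_mulgV1; apply/eqP.
  apply: (gal_eq1_gen genM) => _ /codomP[s ->].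
  by rewrite galM // tu -galM // mulgV gal_id.
have ex_t w : exists t : gal_of M, (t \in 'Gal(M / 1%AS)%g) &&
    [forall s, t (lam s) == lam (to s w)].
  have [t gal_t tE] := act_gal w; exists t; rewrite gal_t /=.
  by apply/forallP => s; rewrite tE.
pose f w := xchoose (ex_t w).
have gal_f w : f w \in 'Gal(M / 1%AS)%g by have /andP[] := xchooseP (ex_t w).
have fE w s : f w (lam s) = lam (to s w).
  by have /andP[_ /forallP/(_ s)/eqP] := xchooseP (ex_t w).
have fM : {in [set: W]%G &, {morph f : w w' / (w * w')%g}}.
  by move=> w w' _ _; apply: gal_eq => s; rewrite galM // !fE actM.
rewrite isog_sym; apply/isogP; exists (Morphism fM) => /=.
  apply/injmP => w w' _ _ /= eq_f; apply/eqP; rewrite eq_mulgV1; apply/eqP.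
  apply: faithful => s; have tw : to s w = to s w'.
    by apply: inj_lam; rewrite -!fE eq_f.
  by rewrite actM tw actK.
apply/setP => t; apply/morphimP/idP => [[w _ _ ->] | gal_t]; first exact: gal_f.
have [w wE] := gal_act t gal_t; exists w; rewrite ?inE //=.
by apply: gal_eq => s; rewrite fE.
Qed.

End Wreath.

(** * Splitting fields of the iterates *)

Lemma splittingFieldFor_scale (F : fieldType) (L : splittingFieldType F)
    (E : {subfield L}) (g : {poly L}) (a b : L) :
    a \in 1%VS -> a != 0 -> b != 0 -> splittingFieldFor 1 g E ->
  splittingFieldFor 1 (b *: (g \Po (a *: 'X))) E.
Proof.
(* The substitution divides the roots by [a]; as [a] lies in the base, they generate the same
   field. *)
move=> base_a a0 b0 [rs g_rs genE]; exists [seq x / a | x <- rs].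
  rewrite (eqp_ltrans (eqp_scale _ b0)) big_map.
  have /eqp_ltrans-> :
      g \Po (a *: 'X) %= (\prod_(x <- rs) ('X - x%:P)) \Po (a *: 'X).
    by have /andP[g_dvd dvd_g] := g_rs; apply/andP; split; apply: dvdp_comp_poly.
  rewrite rmorph_prod /=; elim: (rs) => [|x r IH]; first by rewrite !big_nil eqpxx.
  rewrite !big_cons; apply: eqp_trans (eqp_mull _ IH); apply: eqp_mulr.
  have -> : ('X - x%:P) \Po (a *: 'X) = a *: ('X - (x / a)%:P).
    rewrite comp_polyB comp_polyX comp_polyC scalerBr.
    by rewrite -[a *: _%:P]mul_polyC -polyCM mulrCA divff // mulr1.
  exact: eqp_scale.
rewrite -genE; apply/eqP; rewrite eqEsubv; apply/andP; split.
  apply/(@Fadjoin_seqP _ _ 1%AS); split; first exact: sub1v.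
  move=> _ /mapP[x rs_x ->]; rewrite rpred_div //; first exact: seqv_sub_adjoin.
  by apply: (subvP (sub1v _)).
apply/(@Fadjoin_seqP _ _ 1%AS); split; first exact: sub1v.
move=> x rs_x; rewrite -[x](divfK a0) rpredM //; last by apply: (subvP (sub1v _)).
by apply: seqv_sub_adjoin; apply: map_f.
Qed.

Section SplittingIterate.

Variables (F : fieldType) (L : splittingFieldType F) (M : {subfield L}).
Variables (d n : nat) (c zeta : L).
Hypotheses (d_gt1 : (1 < d)%N) (prim_zeta : d.-primitive_root zeta).
Hypothesis base_c : c \in 1%VS.

Local Notation T := (fun x : L => x ^+ d + c).
Local Notation G := ('X^d + c%:P).

Hypothesis splitM : splittingFieldFor 1 (iter_poly n G) M.

(** F^(n-j) - x divides F^n, the composite of F^j and F^(n-j), so it has a root in [M]; applying F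
    to that root n-j-1 times gives the required [y]. *)
Lemma splitting_children j x : (j < n)%N -> iter j T x = 0 ->
  exists2 y, y \in M & y ^+ d + c = x.
Proof.
move=> lt_jn Tx0; have [rs G_rs genM] := splitM.
pose Q := iter_poly (n - j) G - x%:P.
have sizeQ : size Q = (d ^ (n - j)).+1.
  rewrite size_polyDl size_iter_unicritical // size_polyN size_polyC.
  by apply: leq_ltn_trans (leq_b1 _) _; rewrite ltnS expn_gt0 ltnW.
have Q_dvd : Q %| \prod_(z <- rs) ('X - z%:P).
  rewrite -(eqp_dvdr _ G_rs) -(subnKC (ltnW lt_jn)) iter_polyD.
  have -> : Q = ('X - x%:P) \Po iter_poly (n - j) G.
    by rewrite comp_polyB comp_polyX comp_polyC.
  by apply: dvdp_comp_poly; rewrite dvdp_XsubCl rootE horner_iter_unicritical Tx0.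
have [m Q_m] := dvdp_prod_XsubC Q_dvd.
have [y m_y] : exists y, y \in mask m rs.
  case: (mask m rs) Q_m => [|y r _]; last by exists y; rewrite inE eqxx.
  move/eqp_size; rewrite big_nil sizeQ size_poly1 => /eqP.
  by rewrite eqSS expn_eq0 eqn0Ngt ltnW.
have M_y : y \in M by rewrite -genM; apply: seqv_sub_adjoin; apply: mem_mask m_y.
have : root Q y by rewrite (eqp_root Q_m) root_prod_XsubC.
rewrite rootE hornerD hornerN hornerC subr_eq0 horner_iter_unicritical.
rewrite -(subnSK lt_jn).
rewrite iterS => /eqP <-; exists (iter (n - j.+1) T y) => //.
elim: (n - j.+1)%N => //= i IH.
by rewrite rpredD ?rpredX //; apply: (subvP (sub1v _)).
Qed.

(** Any labelling will do here: it serves to show that the splitting field is Galois, before the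
    labelling by the tree is built. *)
Lemma splitting_all_iter_roots j : (forall j, iter j.+1 T 0 != 0) -> (j <= n)%N ->
  exists (S : finType) (lam : S -> L), all_iter_roots d c lam j.
Proof.
move=> orbit_neq0; elim: j => [|j IH] lt_jn.
  by exists unit, (fun=> 0); apply: all_iter_roots0.
have [S [lam lam_roots]] := IH (ltnW lt_jn); have [_ root_lam _] := lam_roots.
have ex_rho s : exists y, y ^+ d + c == lam s.
  by have [y _ yE] := splitting_children lt_jn (root_lam s); exists y; apply/eqP.
exists (S * 'Z_d)%type, (child zeta (fun s => xchoose (ex_rho s))).
apply: (all_iter_rootsS d_gt1 prim_zeta orbit_neq0 lam_roots) => s.
exact/eqP/(xchooseP (ex_rho s)).
Qed.

Lemma splitting_generated (S : finType) (lam : S -> L) :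
  all_iter_roots d c lam n -> <<1 & codom lam>>%VS = M.
Proof.
move=> lam_roots; have [rs G_rs <-] := splitM.
have eq_rs : codom lam =i rs.
  move=> x; rewrite -root_prod_XsubC -[RHS]root_prod_XsubC -(eqp_root G_rs).
  by rewrite (all_iter_roots_prod d_gt1 lam_roots) big_image.
apply/eqP; rewrite eqEsubv; apply/andP.
by split; apply: adjoin_seqSr => x; rewrite eq_rs.
Qed.

End SplittingIterate.

(** * The Galois group of the iterate *)

Lemma mupX (k : fieldType) (x : k) (q : {poly k}) m :
  q != 0 -> mup x (q ^+ m) = (m * mup x q)%N.
Proof.
move=> q0; elim: m => [|m IH]; first by rewrite mupNroot // root1.
by rewrite exprS mupM ?expf_neq0 // IH mulSn.
Qed.

(** The [d] nonzero elements of the field are all d-th roots of unity, so one of them is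
    primitive. *)
Lemma card_prim_root (k : finFieldType) d :
  #|k| = d.+1 -> (0 < d)%N -> exists z : k, d.-primitive_root z.
Proof.
move=> card_k d_gt0; have sz : size (enum (predC1 (0 : k))) = d.
  by have := cardC1 (0 : k); rewrite card_k /= cardE.
have /hasP[z _ prim_z] : has d.-primitive_root (enum (predC1 (0 : k))).
  apply: has_prim_root; rewrite ?enum_uniq ?sz //.
  apply/allP => x; rewrite mem_enum inE => x0; rewrite unity_rootE.
  by apply/eqP/(mulfI x0); rewrite -exprS -card_k expf_card mulr1.
by exists z.
Qed.

Section Main.

Variables (k : finFieldType) (d p : nat) (u : {fraction {poly k}}).
Hypotheses (card_k : #|k| = d.+1) (d_gt5 : (5 < d)%N) (p_char : p \in [pchar k]).
Hypotheses (dB1_neq0 : d.-1%:R != 0 :> k) (u_neq0 : u != 0).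
Hypothesis vt_c : vt (u ^+ d.-1)^-1 = 0.

(** As u^(d-1) has valuation 0 at t, so has [u]. With u = a/b in lowest terms, t divides neither a
    nor b, and C = t b / a. *)
Lemma fraction_t_unit : exists g h g1 : {poly k},
  [/\ coprimep g h, g = 'X * g1, ~~ root g1 0
    & ratfun_t k / u = tofrac g / tofrac h].
Proof.
have [a [b [b0 co_ab uE]]] := coprime_fraction u.
have a0 : a != 0.
  by apply: contraNneq u_neq0 => a0; rewrite uE a0 tofrac0 mul0r.
have m_gt0 : (0 < d.-1)%N by rewrite -ltnS prednK; apply: leq_trans d_gt5.
have mupE : mup 0 a = mup 0 b.
  have := vt_c; rewrite uE expr_div_n invf_div -!tofracXn.
  rewrite vt_frac ?expf_neq0 // !mupX // => /eqP; rewrite subr_eq0 => /eqP[].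
  by move/eqP; rewrite eqn_pmul2l // => /eqP.
have root_ab : root a 0 = root b 0.
  by rewrite -!dvdp_XsubCl !XsubC_dvd // mupE.
have b_root : ~~ root b 0.
  apply/negP => b_root; have := coprimep_root co_ab; move/(_ 0).
  by rewrite root_ab b_root => /(_ isT); rewrite -rootE b_root.
exists ('X * b), a, b; split=> //.
  by rewrite coprimepMl coprimep_sym coprimepX root_ab b_root coprimep_sym.
by rewrite uE invf_div mulrA /ratfun_t -tofracM.
Qed.

Variables (L : splittingFieldType {fraction {poly k}}) (Kn : {subfield L}) (n : nat).

Variable c : L.
Hypothesis c_def : c = in_alg L (ratfun_t k / u).

Lemma splitting_iterate_galois : (0 < n)%N ->
    splittingFieldFor 1 (iter_poly n ('X^d + c%:P)) Kn ->
  galois 1 Kn /\ ('Gal(Kn / 1%AS) \isog [set: iter_wreath d n])%g.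
Proof.
move=> n_gt0 splitK; have d_gt1 : (1 < d)%N by apply: leq_trans d_gt5.
have [g [h [g1 [co_gh gE g1_0 tuE]]]] := fraction_t_unit.
have cE : c = poly_in L g / poly_in L h by rewrite c_def; apply: in_alg_fraction.
have [z prim_z] := card_prim_root card_k (ltnW d_gt1).
pose zeta := poly_in L z%:P.
have prim_zeta : d.-primitive_root zeta.
  by rewrite (fmorph_primitive_root (@poly_in k L \o polyC)).
have pcharL : p \in [pchar L] := rmorph_pchar (@poly_in k L \o polyC) p_char.
have orbit_neq0 := critical_orbit_neq0 co_gh gE g1_0 d_gt5 cE.
have base_C : c \in 1%VS by rewrite c_def; apply: rpredZ; apply: rpred1.
have base_zeta : zeta \in 1%VS by apply: rpredZ; apply: rpred1.
have [S [lam lam_roots]] := splitting_all_iter_roots d_gt1 prim_zeta base_C splitK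
  orbit_neq0 (leqnn n).
have galK : galois 1 Kn.
  rewrite -(splitting_generated d_gt1 splitK lam_roots).
  exact: (all_iter_roots_galois d_gt5 cE lam_roots).
split=> //.
have kummer := @kummer_level _ _ _ _ _ _ _ co_gh gE g1_0 d_gt5 dB1_neq0 prim_z
  _ pcharL _ cE Kn.
have M_children := splitting_children d_gt1 base_C splitK.
have kum S' lam' rho' j := @kummer S' lam' rho' j galK.
have lt_n : (n.-1 < n)%N by rewrite prednK.
(* This second labelling, by the vertices at level [n] of the tree, carries the wreath product
   action. *)
have [mu [mu_roots M_mu] [mu_real _]] := tree_group_realized d_gt1 prim_zeta base_C
  base_zeta orbit_neq0 M_children kum lt_n.
rewrite prednK // in mu_roots.
apply: realized_isog mu_real _ => //.
- by case: mu_roots.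
- exact: splitting_generated mu_roots.
exact: tree_group_faithful.
Qed.

End Main.

(** d - 1 = q - 2 is congruent to -2 modulo [p], and [p] is odd. *)
Lemma pred_pchar_neq0 (k : finFieldType) p e d :
  prime p -> odd (p ^ e) -> #|k| = (p ^ e)%N -> d.+1 = (p ^ e)%N -> (1 < d)%N ->
  d.-1%:R != 0 :> k.
Proof.
move=> p_prime q_odd card_k dE d_gt1.
have p_char := card_finPcharP card_k p_prime.
rewrite -(dvdn_pcharf p_char); apply/negP => p_dB1.
have e_gt0 : (0 < e)%N by case: e dE {q_odd card_k} => // -[]; lia.
have : (p %| 2)%N.
  rewrite -(dvdn_addr 2 p_dB1) addn2 prednK; last by apply: ltnW.
  by rewrite dE dvdn_exp.
rewrite dvdn_prime2 // => /eqP p2.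
by move: q_odd; rewrite p2 oddX /= orbF -leqn0 leqNgt e_gt0.
Qed.

Lemma iter_poly_conj (F : fieldType) (u : F) (f : {poly F}) n : u != 0 ->
  iter_poly n (u^-1 *: (f \Po (u *: 'X))) = u^-1 *: (iter_poly n f \Po (u *: 'X)).
Proof.
move=> u0; elim: n => [|n IH].
  by rewrite /iter_poly /= comp_polyX scalerA mulVf // scale1r.
rewrite /iter_poly !iterS -!/(iter_poly _ _) IH comp_polyZ -!comp_polyA.
by rewrite comp_polyZ comp_polyX scalerA divff // scale1r.
Qed.

(** Scaling the variable by an element of the base preserves the splitting field; the converse is
    the same scaling by the inverse of [u]. *)
Lemma is_Spl_conj (F : fieldType) (L : splittingFieldType F) (E : {subfield L})
    (u : F) (f : {poly F}) : u != 0 ->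
  is_Spl (u^-1 *: (f \Po (u *: 'X))) E <-> is_Spl f E.
Proof.
move=> u0; have uV0 : u^-1 != 0 by rewrite invr_eq0.
have scale v g : v != 0 -> is_Spl g E -> is_Spl (v^-1 *: (g \Po (v *: 'X))) E.
  move=> v0; rewrite /is_Spl map_polyZ map_comp_poly map_polyZ map_polyX.
  apply: splittingFieldFor_scale; rewrite ?fmorph_eq0 ?invr_eq0 //.
  by apply: rpredZ; apply: rpred1.
split; last exact: scale.
move/(scale _ _ uV0); rewrite invrK comp_polyZ -comp_polyA comp_polyZ comp_polyX.
by rewrite !scalerA divff // !scale1r comp_polyXr.
Qed.

Lemma unicritical_conj (F : fieldType) (u c t : F) d :
    (0 < d)%N -> u != 0 -> c != 0 -> u ^+ d.-1 = c^-1 ->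
  u^-1 *: ((c *: 'X^d + t%:P) \Po (u *: 'X)) = 'X^d + (t / u)%:P.
Proof.
move=> d_gt0 u0 c0 uE.
rewrite comp_polyD comp_polyZ comp_Xn_poly comp_polyC exprZn.
rewrite scalerDr !scalerA; congr (_ + _); last by rewrite -mul_polyC -polyCM mulrC.
have -> : u^-1 * c * u ^+ d = 1; last by rewrite scale1r.
by rewrite -(prednK d_gt0) exprS uE; field; rewrite c0 u0.
Qed.

Lemma map_unicritical (F : fieldType) (L : fieldExtType F) (x : F) d :
  map_poly (in_alg L) ('X^d + x%:P) = 'X^d + (in_alg L x)%:P.
Proof. by rewrite rmorphD /= map_polyXn map_polyC. Qed.

Theorem theorem2 (p e q d : nat) (Fq : finFieldType)
  (c u : {fraction {poly Fq}}) (F : {poly {fraction {poly Fq}}})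
  (p_prime : prime p) (e_gt0 : (0 < e)%N) (q_def : q = (p ^ e)%N)
  (q_odd : odd q) (q_ge7 : (7 <= q)%N) (card_Fq : #|Fq| = q)
  (d_def : d = (q - 1)%N)
  (c_power : exists2 w : {fraction {poly Fq}}, w != 0 & c = w ^+ (d - 1))
  (vt_c : vt c = 0)
  (u_neq0 : u != 0) (u_root : u ^+ (d - 1) = c^-1)
  (F_def : F = u^-1 *: (unicritical d c \Po (u *: 'X))) :
  F = 'X^d + (ratfun_t Fq / u)%:P /\
  forall (n : nat), (0 < n)%N ->
  forall (L : splittingFieldType {fraction {poly Fq}}) (Kn : {subfield L}),
    (is_Spl (iter_poly n F) Kn <-> is_Spl (iter_poly n (unicritical d c)) Kn) /\
    (is_Spl (iter_poly n F) Kn ->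
       galois 1 Kn /\
       ('Gal(Kn / 1%AS) \isog [set: iter_wreath d n])%g).
Proof.
have d_gt5 : (5 < d)%N by rewrite d_def; lia.
have d_gt0 : (0 < d)%N by apply: leq_trans d_gt5.
have dS : d.+1 = q by rewrite d_def; lia.
rewrite subn1 in c_power u_root.
have c0 : c != 0 by case: c_power => w w0 ->; rewrite expf_neq0.
have FE : F = 'X^d + (ratfun_t Fq / u)%:P.
  by rewrite F_def /unicritical (unicritical_conj _ d_gt0 u_neq0 c0 u_root).
split=> [|n n_gt0 L Kn]; first exact: FE.
split.
  (* Conjugation commutes with iteration, so the two iterates differ by the same scaling. *)
  rewrite F_def (iter_poly_conj _ _ u_neq0).
  exact: (is_Spl_conj Kn _ u_neq0).
rewrite /is_Spl map_iter_poly FE map_unicritical => splitK.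
have card_k : #|Fq| = d.+1 by rewrite card_Fq dS.
have card_pe : #|Fq| = (p ^ e)%N by rewrite card_Fq.
have p_char := card_finPcharP card_pe p_prime.
have dB1_neq0 : d.-1%:R != 0 :> Fq.
  apply: (pred_pchar_neq0 p_prime _ card_pe); rewrite -?q_def //.
  by apply: leq_trans d_gt5.
have vt_u : vt (u ^+ d.-1)^-1 = 0 by rewrite u_root invrK.
exact: (splitting_iterate_galois card_k d_gt5 p_char dB1_neq0 u_neq0 vt_u erefl
  n_gt0 splitK).
Qed.
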